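(* Let $\mathcal{O}$ be a one-dimensional noetherian domain whose normalization $\tilde{\mathcal{O}}$ is finitely generated over $\mathcal{O}$, and let $\mathcal{O}'$ be a ring with $\mathcal{O}\subseteq\mathcal{O}'\subseteq\tilde{\mathcal{O}}$. Let $\mathfrak{p}_1,\dots,\mathfrak{p}_r$ be the non-invertible maximal ideals of $\mathcal{O}$. For $1\le i\le r$ let $\mathfrak{P}_{i,1},\dots,\mathfrak{P}_{i,r_i}$ be the maximal ideals of $\mathcal{O}'$ over $\mathfrak{p}_i$, put $d_{i,j}=\deg_{\mathfrak{p}_i}(\mathfrak{P}_{i,j})$ and $g_i=\gcd(d_{i,1},\dots,d_{i,r_i})$. Let $f_*\colon\mathrm{Div}(\mathcal{O}')\to\mathrm{Div}(\mathcal{O})$ and $\overline{f_*}\colon\mathrm{Chow}(\mathcal{O}')\to\mathrm{Chow}(\mathcal{O})$ be the push-forward homomorphisms. (1) The image and kernel of $f_*$ are $$\mathrm{im}(f_* )=\Bigl\{\sum_{\mathfrak{p}\in\mathbb{P}(\mathcal{O})}a_\mathfrak{p}\mathfrak{p}\ \Big|\ a_{\mathfrak{p}_i}\in g_i\mathbb{Z}\text{ for all }1\le i\le r\Bigr\},$$ $$\ker(f_* )=\Bigl\{\sum_{i=1}^r\sum_{j=1}^{r_i}a_{i,j}\mathfrak{P}_{i,j}\ \Big|\ \sum_{j=1}^{r_i}a_{i,j}d_{i,j}=0\text{ for all }1\le i\le r\Bigr\}.$$ In particular, $\mathrm{coker}(f_* )\cong\prod_{i=1}^r\mathbb{Z}/g_i\mathbb{Z}$,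 and $f_*$ is injective if and only if $r_i=1$ for all $i$. (2) The image and kernel of $\overline{f_*}$ are $$\mathrm{im}(\overline{f_*})=\mathrm{im}(f_* )/\mathcal{P}(\mathcal{O})\quad\text{and}\quad\ker(\overline{f_*})=(\ker(f_* )+\mathcal{P}(\mathcal{O}'))/\mathcal{P}(\mathcal{O}').$$ Moreover, $\mathrm{coker}(\overline{f_*})\cong\mathrm{coker}(f_* )$.
   Context: Let $A$ be a one-dimensional noetherian domain with field of fractions $K$ whose normalization (integral closure in $K$) is finitely generated over $A$. $\mathbb{P}(A)$ is the set of maximal ideals of $A$. For $\mathfrak{p}\in\mathbb{P}(A)$, $A_\mathfrak{p}$ is the localization and $\mathrm{ord}_\mathfrak{p}\colon K^*\to\mathbb{Z}$ is the well-defined homomorphism $\frac{a}{b}\mapsto \mathrm{len}_{A_\mathfrak{p}}(A_\mathfrak{p}/aA_\mathfrak{p})-\mathrm{len}_{A_\mathfrak{p}}(A_\mathfrak{p}/bA_\mathfrak{p})$ (nonzero $a,b\in A$), where $\mathrm{len}$ is composition length. $\mathrm{Div}(A)$ is the free abelian group on $\mathbb{P}(A)$; $\mathcal{P}(A)$ is the image of $\mathrm{div}_A\colon K^*\to\mathrm{Div}(A)$, $a\mapsto\sum_{\mathfrak{p}}\mathrm{ord}_\mathfrak{p}(a)\mathfrak{p}$; $\mathrm{Chow}(A)=\mathrm{Div}(A)/\mathcal{P}(A)$. A maximal ideal is called invertible if it is invertible as a fractional ideal; $\mathcal{O}$ has only finitely many non-invertible maximal ideals. For $\mathfrak{P}\in\mathbb{P}(\mathcal{O}')$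 and $\mathfrak{p}=\mathfrak{P}\cap\mathcal{O}\in\mathbb{P}(\mathcal{O})$, let $\deg_\mathfrak{p}(\mathfrak{P})$ be the (finite) degree of the field $\mathcal{O}'/\mathfrak{P}$ over $\mathcal{O}/\mathfrak{p}$. The push-forward $f_*\colon\mathrm{Div}(\mathcal{O}')\to\mathrm{Div}(\mathcal{O})$ sends $\sum_\mathfrak{P}a_\mathfrak{P}\mathfrak{P}$ to $\sum_\mathfrak{P}a_\mathfrak{P}\deg_{\mathfrak{P}\cap\mathcal{O}}(\mathfrak{P})\,(\mathfrak{P}\cap\mathcal{O})$; it satisfies $f_*(\mathrm{div}_{\mathcal{O}'}(a))=\mathrm{div}_{\mathcal{O}}(a)$ for $a\in K^*$, hence induces $\overline{f_*}\colon\mathrm{Chow}(\mathcal{O}')\to\mathrm{Chow}(\mathcal{O})$. *)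

(* Defs.v *)
From HB Require Import structures.
From mathcomp Require Import all_boot all_order all_algebra.
From mathcomp Require Import generic_quotient ring_quotient.
From mathcomp Require Import boolp classical_sets functions cardinality fsbigop.
From mathcomp.multinomials Require Export freeg.

Set Implicit Arguments.
Unset Strict Implicit.
Unset Printing Implicit Defensive.

Import GRing.Theory.

Local Open Scope classical_set_scope.
Local Open Scope ring_scope.
Local Open Scope quotient_scope.

Definition gen_subgroup (G : zmodType) (S : set G) : {pred G} :=
  [pred x | `[< forall H : set G, zmod_closed [in H] -> S `<=` H -> H x >]].

Lemma gen_subgroup_closed (G : zmodType) (S : set G) :
  zmod_closed (gen_subgroup S).
Proof.
split=> [|x y].
  by apply/asboolP => H [H0 _] _; move: H0; rewrite inE.
move=> /asboolP Sx /asboolP Sy; apply/asboolP => H Hcl SH.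
have [_ HB] := Hcl; have := HB x y; rewrite !inE; apply.
  exact: Sx Hcl SH.
exact: Sy Hcl SH.
Qed.

HB.instance Definition _ (G : zmodType) (S : set G) :=
  GRing.isZmodClosed.Build G (gen_subgroup S) (gen_subgroup_closed S).

(* [quotg S] is G / S. It is taken modulo the subgroup generated by S, so that
   it is a group for an arbitrary set S; every S it is applied to below is in
   fact a subgroup. *)
Definition quotg (G : zmodType) (S : set G) : zmodType :=
  Quotient.quot (gen_subgroup S : zmodClosed G).

Definition classg (G : zmodType) (S : set G) : G -> quotg S :=
  \pi_(Quotient.quot (gen_subgroup S : zmodClosed G)).

Definition reprg (G : zmodType) (S : set G) : quotg S -> G :=
  @repr _ (Quotient.quot (gen_subgroup S : zmodClosed G)).

Definition kerg (G H : zmodType) (f : G -> H) : set G := f @^-1` [set 0].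

Definition cokerg (G H : zmodType) (f : G -> H) : zmodType := quotg (range f).

Definition isomg (G H : zmodType) : Prop :=
  exists f : {additive G -> H}, bijective f.

Definition intmod (g : nat) : zmodType :=
  quotg [set z : int | (g %| z)%Z].

Definition prodg (I : Type) (G : I -> zmodType) : Type := forall i, G i.

Section ProductGroup.
Variables (I : Type) (G : I -> zmodType).

HB.instance Definition _ := gen_eqMixin (prodg G).
HB.instance Definition _ := gen_choiceMixin (prodg G).

Let add (x y : prodg G) : prodg G := fun i => x i + y i.
Let opp (x : prodg G) : prodg G := fun i => - x i.
Let zero : prodg G := fun=> 0.

Let addA : associative add.
Proof. by move=> x y z; apply: functional_extensionality_dep => i; apply: addrA. Qed.
Let addC : commutative add.
Proof. by move=> x y; apply: functional_extensionality_dep => i; apply: addrC. Qed.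
Let add0 : left_id zero add.
Proof. by move=> x; apply: functional_extensionality_dep => i; apply: add0r. Qed.
Let addN : left_inverse zero opp add.
Proof. by move=> x; apply: functional_extensionality_dep => i; apply: addNr. Qed.

HB.instance Definition _ := GRing.isZmodule.Build (prodg G) addA addC add0 addN.
End ProductGroup.

Section Subrings.
Variable K : fieldType.
Implicit Types (A I J M N p : set K) (a x : K).

Definition subring A : Prop := subring_closed [in A].

Definition submod A M : Prop :=
  [/\ M 0, (forall x y, M x -> M y -> M (x + y))
         & (forall a x, A a -> M x -> M (a * x))].

Definition ideal A I : Prop := submod A I /\ I `<=` A.

Definition prime_ideal A p : Prop :=
  [/\ ideal A p, ~ p 1
    & forall x y, A x -> A y -> p (x * y) -> p x \/ p y].

Definition maximal_ideal A p : Prop :=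
  [/\ ideal A p, p != A
    & forall I, ideal A I -> p `<=` I -> I = p \/ I = A].

Definition lspan A (s : seq K) : set K :=
  [set x | exists2 c : 'I_(size s) -> K, (forall i, A (c i))
                                       & x = \sum_i c i * s`_i].

Definition finitely_generated A M : Prop := exists s : seq K, M = lspan A s.

Definition noetherian A : Prop :=
  forall I, ideal A I -> finitely_generated A I.

Definition prime_chain A (n : nat) (c : nat -> set K) : Prop :=
  (forall i, (i <= n)%N -> prime_ideal A (c i)) /\
  (forall i, (i < n)%N -> c i `<` c i.+1).

Definition krull_dim A (n : nat) : Prop :=
  (exists c, prime_chain A n c) /\ ~ (exists c, prime_chain A n.+1 c).

Definition fraction_field A : Prop :=
  forall x, exists a b, [/\ A a, A b, b != 0 & x = a / b].

Definition normalization A : set K :=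
  [set x | exists p : {poly K},
     [/\ p \is monic, p \is a polyOver [in A] & root p x]].

Definition fractional_ideal A J : Prop :=
  [/\ submod A J, (exists2 x, J x & x != 0)
    & exists d, [/\ A d, d != 0 & [set d * x | x in J] `<=` A]].

Definition prodmod I J : set K :=
  [set x | exists2 s : seq (K * K), (forall u, u \in s -> I u.1 /\ J u.2)
                                  & x = \sum_(u <- s) u.1 * u.2].

Definition invertible_ideal A I : Prop :=
  exists2 J, fractional_ideal A J & prodmod I J = A.

Definition localization A p : set K :=
  [set x | exists a s, [/\ A a, A s, ~ p s & x = a / s]].

(* Submodules of a quotient M / N are identified with the submodules between
   N and M. *)
Definition simple_quotient A N M : Prop :=
  [/\ submod A N, submod A M, N `<` M
    & forall L, submod A L -> N `<=` L -> L `<=` M -> L = N \/ L = M].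

Definition composition_series A N M (n : nat) (c : nat -> set K) : Prop :=
  [/\ c 0%N = N, c n = M
    & forall i, (i < n)%N -> simple_quotient A (c i) (c i.+1)].

(* The composition length of M / N *)
Definition len A N M : nat :=
  xget 0%N [set n | exists c, composition_series A N M n c].

Definition len_mod_principal A a : nat := len A [set a * x | x in A] A.

(* The value does not depend on the fraction a / b representing x. *)
Definition ord A p x : int :=
  xget 0 [set n : int | exists a b,
    [/\ A a /\ A b, a != 0, b != 0, x = a / b
      & n = (len_mod_principal (localization A p) a)%:Z
            - (len_mod_principal (localization A p) b)%:Z]].

Definition maxspec A : choiceType := set_type [set p | maximal_ideal A p].

Definition Div A : zmodType := {freeg (maxspec A)}.

Definition noninvertible A : set (maxspec A) :=
  [set p | ~ invertible_ideal A (val p)].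
Arguments noninvertible : clear implicits.

Definition principal_divisor A x : Div A :=
  \sum_(p \in [set: maxspec A]) << ord A (val p) x *g p >>.
Arguments principal_divisor : clear implicits.

Definition principal A : set (Div A) :=
  [set principal_divisor A x | x in [set x | x != 0]].
Arguments principal : clear implicits.

Definition Chow A : zmodType := quotg (principal A).

End Subrings.

Arguments noninvertible {K} A.
Arguments principal_divisor {K} A x.
Arguments principal {K} A.

Section PushForward.
Variables (K : fieldType) (A B : set K).
Implicit Types (p : maxspec A) (P : maxspec B).

Definition maxspec_over p : set (maxspec B) :=
  [set P | val P `&` A = val p].

(* The images of b_0, ..., b_{n-1} form a basis of the residue field B / P over
   A / (P `&` A). *)
Definition residue_basis P (n : nat) (b : 'I_n -> K) : Prop :=
  [/\ forall i, B (b i),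
      forall x, B x -> exists2 c : 'I_n -> K,
        (forall i, A (c i)) & val P (x - \sum_i c i * b i)
    & forall c : 'I_n -> K, (forall i, A (c i)) ->
        val P (\sum_i c i * b i) -> forall i, (val P `&` A) (c i)].

Definition residue_degree P : nat :=
  xget 0%N [set n | exists b : 'I_n -> K, residue_basis P b].

Definition gcd_degree p : nat :=
  \big[gcdn/0%N]_(P \in maxspec_over p) residue_degree P.

(* When B is integral over A, the contraction of a maximal ideal is maximal, so
   the branch [None] is never taken. *)
Definition pushforward : Div B -> Div A :=
  fglift (fun P => if insub (val P `&` A) is Some p
                   then << (residue_degree P)%:Z *g p >> else 0 : {freeg (maxspec A)}).

(* The map induced by [pushforward]; it does not depend on the choice of
   representatives since [pushforward] preserves principal divisors. *)
Definition pushforward_chow : Chow B -> Chow A :=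
  fun x => classg (principal A) (pushforward (reprg x)).

End PushForward.

Arguments pushforward {K} A B.
Arguments pushforward_chow {K} A B.
Arguments residue_degree {K} A {B} P.
Arguments maxspec_over {K A} B p.
Arguments gcd_degree {K A} B p.

(* Main.v *)
Require Import Defs.
From HB Require Import structures.
From mathcomp Require Import all_boot all_order all_algebra.
From mathcomp Require Import boolp classical_sets functions cardinality fsbigop.
From mathcomp Require Import ring.
Set Implicit Arguments.
Unset Strict Implicit.
Import GRing.Theory.
Local Open Scope classical_set_scope.
Local Open Scope ring_scope.

(** The proof rests on one length formula: for nonzero [x] in [K] and [p] in
    [maxspec O],

      ord_p x = \sum_(P over p) [O'/P : O/p] * ord_P x,

    that is, the push-forward sends the divisor of [x] on [O'] to its divisor on
    [O] ([pushforward_principal]).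

    Lengths are handled for submodules [N <= M] of [K] over a subring [A].  A
    composition series of [M / N] has factors [A / P]; after localization at
    [Q] the factors with [P = Q] stay simple and the others vanish, so the local
    length at [Q] is the number of factors [A / Q].  Over a smaller ring [O], a
    factor [O'/P] of an [O']-module has length [[O'/P : O/p]], all concentrated
    at [p = P `&` O] ([composition_factors_length]).  Applied to a composition
    series of [O'/a O'], this computes the length of [O'/a O'] at [p] as the
    right-hand side for [x = a].  It equals the length of [O/a O] at [p] since
    multiplication by [a] preserves the finite length of [O'/O]
    ([len_extension]).  All these lengths are finite because [O] has finite
    length modulo every nonzero element ([noetherian_finite_length]) and because
    the normalization has a common denominator [d], so that [d O' <= O].

    The formula gives everything about the fibres.  For nonzero [x] in [p] the
    left-hand side is positive, so some [P] lies over [p] ([lying_over]).  If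
    [p] is invertible, some [x] in [p] has order [1] at [p], and then the right-
    hand side leaves room for a single [P], of degree [1] ([invertible_over]).
    If [d] is not in [p], then [O'/P = O/p] for [P] over [p]; hence the gcd of
    the degrees differs from [1] only at the finitely many [p] containing [d]
    ([gcd_degree1]).

    With this, the image of the push-forward is given by Bezout over each [p],
    its kernel by comparing coefficients, and its cokernel by the first
    isomorphism theorem.  The statements on Chow groups follow formally from
    the fact that the push-forward maps principal divisors onto principal
    divisors. *)

(** * Length of quotients of submodules of a field *)

Section Submodules.
Variables (K : fieldType) (A : set K).
Hypothesis sA : subring A.
Implicit Types (L M N J : set K) (a b x y z : K).

Lemma subring1 : A 1.
Proof. by case: sA; rewrite inE. Qed.

Lemma subringB x y : A x -> A y -> A (x - y).
Proof. by case: sA => _ h _ Ax Ay; have := h x y; rewrite !inE; apply. Qed.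

Lemma subringM x y : A x -> A y -> A (x * y).
Proof. by case: sA => _ _ h Ax Ay; have := h x y; rewrite !inE; apply. Qed.

Lemma subring0 : A 0.
Proof. by rewrite -(subrr 1); apply: subringB; apply: subring1. Qed.

Lemma subringN x : A x -> A (- x).
Proof. by rewrite -sub0r; apply: subringB; apply: subring0. Qed.

Lemma subringD x y : A x -> A y -> A (x + y).
Proof. by move=> Ax Ay; rewrite -[y]opprK; apply: subringB => //; exact: subringN. Qed.

Lemma submodN M x : submod A M -> M x -> M (- x).
Proof.
by case=> _ _ h Mx; rewrite -mulN1r; apply: h => //; apply/subringN/subring1.
Qed.

Lemma submodB M x y : submod A M -> M x -> M y -> M (x - y).
Proof. by move=> sM Mx My; case: (sM) => _ h _; apply: h => //; exact: submodN. Qed.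

Lemma submod_self : submod A A.
Proof. by split; [exact: subring0 | exact: subringD | exact: subringM]. Qed.

Lemma submodI M N : submod A M -> submod A N -> submod A (M `&` N).
Proof.
case=> M0 MD MM [N0 ND NM]; split=> // [x y [? ?] [? ?]|a x Aa [? ?]].
  by split; [apply: MD | apply: ND].
by split; [apply: MM | apply: NM].
Qed.

(** The submodule [N + z J]; taking [J := A] adjoins the generator [z] to [N],
    taking [N := 0] scales [J] by [z]. *)
Definition addmul N z J : set K :=
  [set y | exists n j, [/\ N n, J j & y = n + z * j]].

Lemma addmul_submod N z J : submod A N -> submod A J -> submod A (addmul N z J).
Proof.
case=> N0 ND NM [J0 JD JM]; split.
- by exists 0, 0; split=> //; rewrite mulr0 addr0.
- move=> x y [n [j [Nn Jj ->]]] [n' [j' [Nn' Jj' ->]]].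
  by exists (n + n'), (j + j'); split; [exact: ND | exact: JD | ring].
- move=> a x Aa [n [j [Nn Jj ->]]].
  by exists (a * n), (a * j); split; [exact: NM | exact: JM | ring].
Qed.

Lemma sub_addmul N z J : J 0 -> N `<=` addmul N z J.
Proof. by move=> J0 n Nn; exists n, 0; split=> //; rewrite mulr0 addr0. Qed.

Lemma addmul_gen N z : N 0 -> addmul N z A z.
Proof. by move=> N0; exists 0, 1; split=> //; [exact: subring1 | ring]. Qed.

Lemma addmul_sub N z J M : submod A M -> N `<=` M ->
  (forall j, J j -> M (z * j)) -> addmul N z J `<=` M.
Proof.
by case=> _ MD _ NM h _ [n [j [/NM Nn /h Jj ->]]]; apply: MD.
Qed.

Lemma addmul_id N z J : submod A N -> J 0 -> (forall j, J j -> N (z * j)) ->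
  addmul N z J = N.
Proof.
move=> sN J0 h; rewrite eqEsubset; split; last exact: sub_addmul.
exact: addmul_sub.
Qed.

Lemma addmul0 z J : addmul [set 0] z J = [set z * x | x in J].
Proof.
rewrite eqEsubset; split=> [_ [_ [j [-> Jj ->]]]|_ [j Jj <-]].
  by exists j => //; rewrite add0r.
by exists 0, j; split=> //; rewrite add0r.
Qed.

Lemma submod0 : submod A [set 0].
Proof.
split=> //= [x y -> ->|a x _ ->]; first by rewrite addr0.
by rewrite mulr0.
Qed.

Lemma scale_submod z J : submod A J -> submod A [set z * x | x in J].
Proof. by rewrite -addmul0; apply: addmul_submod; exact: submod0. Qed.

Lemma simple_quotient_gen N M x : simple_quotient A N M -> M x -> ~ N x ->
  M = addmul N x A.
Proof.
move=> [sN sM [NM _] h] Mx Nx; have [N0 _ _] := sN.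
have [||| e|//] := h (addmul N x A).
- by apply: addmul_submod => //; exact: submod_self.
- exact/sub_addmul/subring0.
- apply: addmul_sub => // a Aa; rewrite mulrC.
  by case: sM => _ _; apply.
- by case: Nx; rewrite -e; apply: addmul_gen.
Qed.

(** Simple quotients are the cyclic ones [(N + x A) / N] on whose nonzero
    elements [a x] one can undo the multiplication by [a].  This is a form that
    passes easily through multiplications and localizations. *)
Lemma simple_quotientP N M :
  simple_quotient A N M <->
  submod A N /\ exists2 x, ~ N x & M = addmul N x A /\
    forall a, A a -> N (a * x) \/ exists2 b, A b & N (x - b * (a * x)).
Proof.
split=> [NM|[sN [x Nx [-> h]]]].
  have [sN sM [_ nMN] _] := NM; have [x [Mx Nx]] := nonsubset nMN.
  split=> //; exists x => //; split; first exact: simple_quotient_gen.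
  move=> a Aa; case: (pselect (N (a * x))) => [|Nax]; [by left | right].
  have Max : M (a * x) by case: sM => _ _; apply.
  move: Mx; rewrite (simple_quotient_gen NM Max Nax) => -[n [b [Nn Ab e]]].
  exists b => //; suff -> : x - b * (a * x) = n by [].
  by rewrite {1}e; ring.
have [N0 _ _] := sN.
have gx : addmul N x A x by apply: addmul_gen.
split=> //; first by apply: addmul_submod => //; exact: submod_self.
  split; first exact/sub_addmul/subring0.
  by move=> H; apply/Nx/H.
move=> L sL NL LM; case: (pselect (L `<=` N)) => [LN|].
  by left; rewrite eqEsubset.
move=> nLN; right; rewrite eqEsubset; split=> //.
have [y [Ly Ny]] := nonsubset nLN.
have Lx : L x.
  have [n [a [Nn Aa e]]] := LM y Ly.
  have Lax : L (a * x).
    suff -> : a * x = y - n by apply: submodB => //; exact: NL.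
    by rewrite e; ring.
  have [Nax|[b Ab Nb]] := h a Aa.
    by case: Ny; rewrite e mulrC; case: sN => _ + _; apply.
  rewrite -[x](subrK (b * (a * x))).
  case: (sL) => _ LD LMu; apply: LD; first exact: NL.
  exact: LMu.
apply: addmul_sub => // a Aa; rewrite mulrC.
by case: sL => _ _; apply.
Qed.

(** Multiplication by [z] maps [J' / J] onto [(N + z J') / (N + z J)]; the
    hypothesis on [N] makes this an isomorphism. *)
Lemma simple_quotient_addmul N z J J' : submod A N -> simple_quotient A J J' ->
  (forall y, J' y -> N (z * y) -> J y) ->
  simple_quotient A (addmul N z J) (addmul N z J').
Proof.
move=> sN /simple_quotientP [sJ [x Jx [-> h]]] inj.
apply/simple_quotientP; split; first exact: addmul_submod.
have [J0 JD _] := sJ.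
have gx : addmul J x A x by apply: addmul_gen.
exists (z * x); first move=> [n [j [Nn Jj e]]].
  apply: Jx; rewrite -[x](subrK j); apply: JD => //; apply: inj.
    apply: submodB => //; last by apply: sub_addmul => //; exact: subring0.
    by apply: addmul_submod => //; exact: submod_self.
  by rewrite mulrBr e addrK.
split.
  rewrite eqEsubset; split=> y.
    move=> [n [_ [Nn [j [a [Jj Aa ->]]] ->]]].
    exists (n + z * j), a; split=> //; last by ring.
    by exists n, j.
  move=> [_ [a [[n [j [Nn Jj ->]]] Aa ->]]].
  exists n, (j + x * a); split=> //; last by ring.
  by exists j, a.
move=> a Aa; have [Jax|[b Ab Jb]] := h a Aa; [left | right].
  exists 0, (a * x); split=> //; last by ring.
  by case: sN.
exists b => //; exists 0, (x - b * (a * x)); split=> //; last by ring.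
by case: sN.
Qed.

Definition has_length N M n := exists c, composition_series A N M n c.

Lemma has_length0 N : has_length N N 0.
Proof. by exists (fun=> N). Qed.

Lemma has_length0P N M : has_length N M 0 -> N = M.
Proof. by case=> c [-> -> _]. Qed.

Lemma has_lengthS N L M n :
  has_length N L n -> simple_quotient A L M -> has_length N M n.+1.
Proof.
move=> [c [c0 cn h]] LM; exists (fun i => if (i <= n)%N then c i else M).
split=> //=; first by rewrite ltnn.
move=> i; rewrite ltnS => lin; rewrite lin.
by case: ltngtP lin => // [lt|->] _; [exact: h | rewrite cn].
Qed.

Lemma has_lengthSP N M n : has_length N M n.+1 ->
  exists2 L, has_length N L n & simple_quotient A L M.
Proof.
move=> [c [c0 cn h]]; exists (c n).
  exists c; split=> // i lin; apply: h; exact: ltnW.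
by rewrite -cn; apply: h.
Qed.

Lemma has_length_simple N M : simple_quotient A N M -> has_length N M 1.
Proof. exact/has_lengthS/has_length0. Qed.

Lemma has_length_sub N M n : has_length N M n -> N `<=` M.
Proof.
elim: n M => [|n IH] M; first by move/has_length0P => ->.
case/has_lengthSP => L /IH NL [_ _ [LM _] _]; exact: subset_trans LM.
Qed.

Lemma has_length_trans N L M n m :
  has_length N L n -> has_length L M m -> has_length N M (n + m).
Proof.
move=> hn; elim: m M => [|m IH] M; first by move/has_length0P <-; rewrite addn0.
by case/has_lengthSP => L' /IH hL'; rewrite addnS; apply: has_lengthS.
Qed.

Lemma has_length_addmul N z J J' n : submod A N -> has_length J J' n ->
  (forall y, J' y -> N (z * y) -> J y) ->
  has_length (addmul N z J) (addmul N z J') n.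
Proof.
move=> sN; elim: n J' => [|n IH] J'.
  by move/has_length0P <- => _; exact: has_length0.
case/has_lengthSP => L hL LJ' inj.
have JL := has_length_sub hL; have [_ _ [LJ'sub _] _] := LJ'.
apply: (@has_lengthS _ (addmul N z L)).
  by apply: IH => // y Ly; apply/inj/LJ'sub.
by apply: simple_quotient_addmul => // y Jy /inj -/(_ Jy); exact: JL.
Qed.

Lemma has_length_scale z J J' n : z != 0 -> submod A J -> has_length J J' n ->
  has_length [set z * x | x in J] [set z * x | x in J'] n.
Proof.
move=> z0 [J0 _ _] h; rewrite -!addmul0; apply: has_length_addmul => //.
  exact: submod0.
by move=> y _ /eqP; rewrite mulf_eq0 (negPf z0) => /eqP ->.
Qed.

(** In one step [M' < M] of a composition series, either [L] stays inside
    [M'], and then the step is one of [M / L]; or [L] generates [M] over [M'],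
    and then the step is [L / (L `&` M')], while [M / L] is [M' / (L `&` M')]. *)
Lemma has_length_split N L M n : submod A L -> has_length N M n ->
  N `<=` L -> L `<=` M ->
  exists k l, [/\ has_length N L k, has_length L M l & (k + l)%N = n].
Proof.
move=> sL; elim: n M L sL => [|n IH] M L sL.
  move/has_length0P <- => NL LN; have -> : L = N by rewrite eqEsubset.
  by exists 0%N, 0%N; split=> //; exact: has_length0.
case/has_lengthSP => M' hM' M'M NL LM; have [sM' _ _ _] := M'M.
have NM' := has_length_sub hM'.
have [|||k [l [hk hl ekl]]] := IH M' (L `&` M') _ hM'.
- exact: submodI.
- by move=> x Nx; split; [exact: NL | exact: NM'].
- by move=> x [].
case: (pselect (L `<=` M')) => [LM'|nLM'].
  move: hk hl; rewrite (setIidl LM') => hk hl.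
  by exists k, l.+1; split=> //; [exact: has_lengthS hl M'M | rewrite addnS ekl].
have [x [Lx M'x]] := nonsubset nLM'; have [_ _ [M'subM _] _] := M'M.
have [M'0 _ _] := sM'; have [L0 LD LMu] := sL.
have LA a : A a -> L (x * a) by move=> Aa; rewrite mulrC; apply: LMu.
have eM := simple_quotient_gen M'M (LM x Lx) M'x.
exists k.+1, l; split; last by rewrite -ekl.
  apply: (has_lengthS hk); apply/simple_quotientP; split; first exact: submodI.
  exists x; first by case.
  split.
    rewrite eqEsubset; split=> [y Ly|].
      have := LM y Ly; rewrite {1}eM => -[m [a [Mm Aa e]]].
      exists m, a; split=> //; split=> //.
      suff -> : m = y - x * a by apply: submodB => //; apply: LA.
      by rewrite e; ring.
    by apply: addmul_sub => // y [].
  move=> a Aa; case: (pselect (M' (a * x))) => [M'ax|M'ax].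
    by left; split=> //; rewrite mulrC; apply: LA.
  have Lax : L (a * x) by rewrite mulrC; apply: LA.
  have eM2 := simple_quotient_gen M'M (LM _ Lax) M'ax.
  right; have := LM x Lx; rewrite eM2 => -[m [b [Mm Ab e]]].
  exists b => //; have -> : x - b * (a * x) = m by rewrite {1}e; ring.
  split=> //; have -> : m = x - x * (a * b) by rewrite {1}e; ring.
  by apply: submodB => //; apply/LA/subringM.
have e1 : addmul L 1 (L `&` M') = L.
  by apply: addmul_id => // y [Ly _]; rewrite mul1r.
have e2 : addmul L 1 M' = M.
  rewrite eqEsubset; split.
    apply: addmul_sub => //; first by case: M'M.
    by move=> y /M'subM; rewrite mul1r.
  rewrite eM => _ [m [a [Mm Aa ->]]]; exists (x * a), m; split=> //.
    exact: LA.
  by ring.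
rewrite -e2 -[X in has_length X]e1; apply: has_length_addmul => // y M'y.
by rewrite mul1r.
Qed.

(** The Jordan-Hölder theorem for lengths: splitting the first series along the
    last proper term of the second reduces to shorter series. *)
Lemma has_length_uniq N M n m : has_length N M n -> has_length N M m -> n = m.
Proof.
suff H0 L L' k : has_length L L' k.+1 -> L = L' -> False.
  elim: n M m => [|n IH] M [|m] //.
  - by move=> /has_length0P e h; case: (H0 _ _ _ h).
  - by move=> h /has_length0P e; case: (H0 _ _ _ h).
  move=> hn /has_lengthSP [L hL LM]; have [sL sM [LsubM nML] maxL] := LM.
  have [k [l [hk hl ekl]]] := has_length_split sL hn (has_length_sub hL) LsubM.
  case: l => [|l] in hl ekl; first by case: nML; rewrite -(has_length0P hl).
  have /has_lengthSP [L' hL' L'M] := hl; have [sL' _ [L'M1 nML'] _] := L'M.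
  have [eL|eL] := maxL L' sL' (has_length_sub hL') L'M1; last first.
    by case: nML'; rewrite eL.
  case: l => [|l] in hl ekl hL'; last by case: (H0 _ _ _ hL').
  move: ekl; rewrite addn1 => -[ek]; rewrite ek in hk.
  by rewrite (IH _ _ hk hL).
move=> /has_lengthSP [L'' h [_ _ [_ nsub] _]] e; apply: nsub; rewrite -e.
exact: has_length_sub h.
Qed.

Lemma len_eq N M n : has_length N M n -> len A N M = n.
Proof.
move=> h; apply: xget_unique => //= m hm.
exact: has_length_uniq hm h.
Qed.

End Submodules.
(** * Localization at a maximal ideal *)

Section Localization.
Variables (K : fieldType) (A : set K).
Hypothesis sA : subring A.
Implicit Types (L M N J p q : set K) (a b x y z : K).

Lemma maximal_submod p : maximal_ideal A p -> submod A p.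
Proof. by case=> -[]. Qed.

Lemma maximal_sub p : maximal_ideal A p -> p `<=` A.
Proof. by case=> -[]. Qed.

Lemma maximal_simple p : maximal_ideal A p -> simple_quotient A p A.
Proof.
case=> -[sp pA] /eqP npA hp; split=> //; first exact: submod_self.
  by split=> // Ap; apply: npA; rewrite eqEsubset.
by move=> L sL pL LA; apply: hp.
Qed.

Lemma simple_maximal p : simple_quotient A p A -> maximal_ideal A p.
Proof.
case=> sp _ [pA nAp] h; split=> //.
  by apply/eqP => e; apply: nAp; rewrite e.
by move=> I [sI IA] pI; apply: h.
Qed.

Lemma maximal_inv p a : maximal_ideal A p -> A a -> ~ p a ->
  exists2 b, A b & p (1 - b * a).
Proof.
move=> mp Aa pa; have [[sp pA] npA hp] := mp.
have [p0 _ _] := sp.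
have [||e|e] := hp (addmul p a A).
- split; first by apply: addmul_submod => //; exact: submod_self.
  by apply: addmul_sub => //; [exact: submod_self | move=> b Ab; exact: subringM].
- by apply: sub_addmul; exact: subring0.
- by case: pa; rewrite -e; apply: addmul_gen.
have : A 1 by exact: subring1.
rewrite -{1}e => -[m [b [pm Ab e1]]]; exists b => //.
by rewrite e1 [b * a]mulrC addrK.
Qed.

Lemma maximal_not1 p : maximal_ideal A p -> ~ p 1.
Proof.
move=> [[sp pA] /eqP npA _] p1; apply: npA; rewrite eqEsubset; split=> // a Aa.
by rewrite -[a]mulr1; case: sp => _ _; apply.
Qed.

Lemma maximal_prime p a b : maximal_ideal A p -> A a -> A b ->
  ~ p a -> ~ p b -> ~ p (a * b).
Proof.
move=> mp Aa Ab pa pb pab; have [c Ac hc] := maximal_inv mp Aa pa.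
have [p0 pD pM] := maximal_submod mp.
apply: pb; have -> : b = b * (1 - c * a) + c * (a * b) by ring.
by apply: pD; apply: pM.
Qed.

Lemma maximal_neq0 p a : maximal_ideal A p -> ~ p a -> a != 0.
Proof.
move=> mp pa; apply/eqP => e; apply: pa; rewrite e.
by case: (maximal_submod mp).
Qed.

(** If [0] were a maximal ideal, then [z] would be invertible. *)
Lemma maximal_nonzero p z : maximal_ideal A p -> A z -> z != 0 -> ~ A z^-1 ->
  exists2 x, p x & x != 0.
Proof.
move=> mp Az z0 nAz; apply: contrapT => H.
have p0 x : p x -> x = 0.
  by move=> px; apply/eqP; apply: contrapT => /negP x0; apply: H; exists x.
have [|b Ab /p0/subr0_eq e] := maximal_inv mp Az; first by move/p0/eqP; apply/negP.
apply: nAz; suff -> : z^-1 = b by [].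
by apply: (mulIf z0); rewrite mulVf.
Qed.

Lemma maximal_sub_eq p q : maximal_ideal A p -> maximal_ideal A q ->
  p `<=` q -> p = q.
Proof.
move=> [_ _ hp] [iq /eqP nqA _] pq; by case: (hp q iq pq).
Qed.

(** The localization of a submodule at the complement of [p]; for the submodule
    [A] it is [localization A p]. *)
Definition locmod p M : set K :=
  [set x | exists m s, [/\ M m, A s, ~ p s & x = m / s]].

Section AtMaximal.
Variables (p : set K) (mp : maximal_ideal A p).
Notation Ap := (localization A p).

Lemma loc_sub M : M `<=` locmod p M.
Proof.
move=> m Mm; exists m, 1; split=> //; first exact: subring1.
  exact: (maximal_not1 mp).
by rewrite divr1.
Qed.

Lemma locmod_sub M N : M `<=` N -> locmod p M `<=` locmod p N.
Proof. by move=> MN x [m [s [/MN Nm ? ? ->]]]; exists m, s. Qed.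

Lemma loc_inv s : A s -> ~ p s -> Ap (s^-1).
Proof.
move=> As ps; exists 1, s; split=> //; last by rewrite div1r.
exact: subring1.
Qed.

Lemma locmodB M x y : submod A M -> locmod p M x -> locmod p M y ->
  locmod p M (x - y).
Proof.
move=> sM [m [s [Mm As ps ->]]] [n [t [Mn At pt ->]]].
have [_ _ MM] := sM.
exists (t * m - s * n), (s * t); split.
- by apply: (submodB sA sM); exact: MM.
- exact: subringM.
- exact: (maximal_prime mp As At ps pt).
- have s0 := maximal_neq0 mp ps; have t0 := maximal_neq0 mp pt.
  by field; rewrite s0 t0.
Qed.

Lemma locmodM M x y : (forall a m, A a -> M m -> M (a * m)) ->
  Ap x -> locmod p M y -> locmod p M (x * y).
Proof.
move=> MM [m [s [Mm As ps ->]]] [n [t [Mn At pt ->]]].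
exists (m * n), (s * t); split.
- exact: MM.
- exact: subringM.
- exact: (maximal_prime mp As At ps pt).
- by rewrite mulf_div.
Qed.

Lemma loc_subring : subring Ap.
Proof.
split; rewrite ?inE.
- by apply: loc_sub; exact: subring1.
- by move=> x y; rewrite !inE; apply: locmodB; exact: submod_self.
- by move=> x y; rewrite !inE; apply: locmodM => *; exact: subringM.
Qed.

Lemma locmod_submod M : submod A M -> submod Ap (locmod p M).
Proof.
move=> sM; have [M0 _ MM] := sM.
have L0 : locmod p M 0 by exact: loc_sub.
split=> // [x y Mx My|a x Aa Mx]; last exact: locmodM.
have My' : locmod p M (0 - y) by apply: locmodB.
by rewrite -[y]opprK -[- y]sub0r; apply: locmodB.
Qed.

Lemma locmod_scale M z :
  locmod p [set z * x | x in M] = [set z * x | x in locmod p M].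
Proof.
rewrite eqEsubset; split=> [_ [_ [s [[m Mm <-] As ps ->]]]|].
  by exists (m / s); [exists m, s | rewrite mulrA].
move=> _ [_ [m [s [Mm As ps ->]]] <-].
by exists (z * m), s; split=> //; [exists m | rewrite mulrA].
Qed.

(** The generator [x] of [M / N] stays a generator; it does not die because only
    multipliers in [p] kill it, and a fraction [a / s] with [a] outside [p] is
    undone by [s / a]. *)
Lemma locmod_simple N M : simple_quotient A N M ->
  (forall a x, p a -> M x -> N (a * x)) ->
  simple_quotient Ap (locmod p N) (locmod p M).
Proof.
move=> NM ann; have /simple_quotientP [//|sN [x Nx [eM h]]] := NM.
have [sN' sM [NsubM _] _] := NM; have [N0 ND NMu] := sN.
have Mx : M x by rewrite eM; apply: addmul_gen.
apply/(simple_quotientP loc_subring); split; first exact: locmod_submod.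
exists x.
  move=> [n [s [Nn As ps e]]]; have s0 := maximal_neq0 mp ps.
  have Nsx : N (s * x) by rewrite e mulrC divfK.
  have [b Ab pb] := maximal_inv mp As ps.
  apply: Nx; have -> : x = (1 - b * s) * x + b * (s * x) by ring.
  by apply: ND; [exact: ann | exact: NMu].
split.
  rewrite eqEsubset; split=> [_ [m [s [Mm As ps ->]]]|].
    move: Mm; rewrite eM => -[n [a [Nn Aa ->]]].
    exists (n / s), (a / s); split; [by exists n, s | by exists a, s |].
    by rewrite mulrA mulrDl.
  apply: addmul_sub; first exact: locmod_submod.
    exact: locmod_sub.
  move=> a Apa; rewrite mulrC; apply: locmodM => //; last exact: loc_sub.
  by case: sM.
move=> _ [a [s [Aa As ps ->]]]; have s0 := maximal_neq0 mp ps.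
case: (pselect (p a)) => pa; [left | right].
  exists (a * x), s; split=> //; first exact: ann.
  by rewrite mulrAC.
have a0 := maximal_neq0 mp pa.
exists (s / a); first by exists s, a.
have -> : x - s / a * (a / s * x) = 0 by field; rewrite ?a0 ?s0.
exact: loc_sub.
Qed.

(** A multiplier [t] outside [p] that kills [M / N] becomes invertible. *)
Lemma locmod_eq N M : submod A M -> N `<=` M ->
  (exists2 t, A t /\ ~ p t & forall x, M x -> N (t * x)) ->
  locmod p N = locmod p M.
Proof.
move=> sM NM [t [At pt] h]; rewrite eqEsubset; split; first exact: locmod_sub.
move=> _ [m [s [Mm As ps ->]]]; exists (t * m), (t * s); split.
- exact: h.
- exact: subringM.
- exact: (maximal_prime mp At As pt ps).
- by rewrite -mulf_div divff ?mul1r //; exact: (maximal_neq0 mp pt).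
Qed.

Lemma locmod_length N M n : has_length A N M n ->
  (forall a x, p a -> M x -> N (a * x)) ->
  has_length Ap (locmod p N) (locmod p M) n.
Proof.
elim: n M => [|n IH] M; first by move/has_length0P <- => _; exact: has_length0.
case/has_lengthSP => L hL LM ann.
have NL := has_length_sub hL; have [sL sM [LsubM _] _] := LM.
apply: (@has_lengthS _ _ _ (locmod p L)).
  by apply: IH => // a x pa /LsubM; exact: ann.
by apply: locmod_simple => // a x pa Mx; apply/NL/ann.
Qed.

End AtMaximal.
End Localization.

(** * Annihilators of composition factors *)

Section Factors.
Variables (K : fieldType) (B : set K).
Hypothesis sB : subring B.
Implicit Types (L M N : set K).

(** [s] lists the annihilators of the factors of a composition series of
    [M / N], from top to bottom. *)
Fixpoint composition_factors N M (s : seq (maxspec B)) : Prop :=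
  if s is P :: s' then
    exists L, [/\ composition_factors N L s', simple_quotient B L M
                & forall a x, val P a -> M x -> L (a * x)]
  else N = M.

Lemma maxspecP (P : maxspec B) : maximal_ideal B (val P).
Proof. by have := valP P; rewrite inE. Qed.

(** [M / L] being generated by any [x] outside [L], its annihilator is that of
    the class of [x], and it is maximal because [B / P] is simple. *)
Lemma simple_annihilator L M : simple_quotient B L M ->
  exists P : maxspec B, forall a x, val P a -> M x -> L (a * x).
Proof.
move=> LM; have /(simple_quotientP sB) [sL [x Lx [eM h]]] := LM.
have [_ sM [LsubM _] _] := LM; have [L0 LD LMu] := sL; have [_ _ MMu] := sM.
have Mx : M x by rewrite eM; apply: addmul_gen.
pose P := [set a | B a /\ L (a * x)].
have mP : maximal_ideal B P.
  apply: simple_maximal; apply/(simple_quotientP sB).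
  have sP : submod B P.
    split.
    - by split; [exact: subring0 | rewrite mul0r].
    - move=> a b [Ba La] [Bb Lb]; split; first exact: subringD.
      by rewrite mulrDl; apply: LD.
    - move=> a b Ba [Bb Lb]; split; first exact: subringM.
      by rewrite -mulrA; apply: LMu.
  split=> //; exists 1; first by case=> _; rewrite mul1r.
  have B1 := subring1 sB.
  split.
    rewrite eqEsubset; split=> [a Ba|].
      exists 0, a; split=> //; last by rewrite add0r mul1r.
      by split; [exact: subring0 | rewrite mul0r].
    apply: addmul_sub; first exact: submod_self.
      by move=> a [].
    by move=> a; rewrite mul1r.
  move=> a Ba; have [Lax|[b Bb Lb]] := h a Ba; [left | right].
    by rewrite mulr1.
  exists b => //; split.
    by apply: subringB => //; apply: subringM => //; rewrite mulr1.
  by rewrite mulr1 mulrBl mul1r -mulrA.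
exists (SigSub (mem_set mP)) => a y /= [Ba Lax]; rewrite eM.
move=> [l [b [Ll Bb ->]]]; rewrite mulrDr; apply: LD; first exact: LMu.
by rewrite mulrCA mulrC -mulrA mulrCA; apply: LMu; rewrite // mulrC.
Qed.

Lemma has_length_factors N M n : has_length B N M n ->
  exists s, composition_factors N M s.
Proof.
elim: n M => [|n IH] M; first by move/has_length0P => e; exists [::].
case/has_lengthSP => L /IH [s hs] LM; have [P hP] := simple_annihilator LM.
by exists (P :: s); exists L.
Qed.

End Factors.

(** * Length under restriction of scalars *)

Section Extension.
Variables (K : fieldType) (A B : set K).
Hypotheses (sA : subring A) (sB : subring B) (AB : A `<=` B).
Implicit Types (L M N : set K).

Lemma submod_restr M : submod B M -> submod A M.
Proof. by case=> M0 MD MM; split=> // a x /AB; apply: MM. Qed.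

(** A composition series over the smaller ring bounds the length of chains of
    submodules over the larger one. *)
Lemma has_length_extend N M n : submod B N -> submod B M ->
  has_length A N M n -> exists m, has_length B N M m.
Proof.
elim/ltn_ind: n N M => n IH N M sN sM h.
case: (pselect (N = M)) => [->|nNM]; first by exists 0%N; exact: has_length0.
have NM := has_length_sub h.
case: (pselect (simple_quotient B N M)) => [/has_length_simple|ns]; first by exists 1%N.
have [L [sL [NL LM] [nLN nLM]]] :
    exists L, [/\ submod B L, N `<=` L /\ L `<=` M & L <> N /\ L <> M].
  apply: contrapT => H; apply: ns; split=> //.
    by split=> // MN; apply: nNM; rewrite eqEsubset.
  move=> L sL NL LM; apply: contrapT => /not_orP nL.
  by apply: H; exists L.
have [k [l [hk hl ekl]]] := has_length_split sA (submod_restr sL) h NL LM.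
have k0 : (0 < k)%N.
  by case: k hk {ekl} => // /has_length0P e; case: nLN.
have l0 : (0 < l)%N.
  by case: l hl {ekl} => // /has_length0P e; case: nLM.
have [|k' hk'] := IH k _ N L sN sL hk.
  by rewrite -ekl -addn1 leq_add2l.
have [|l' hl'] := IH l _ L M sL sM hl.
  by rewrite -ekl -add1n leq_add2r.
by exists (k' + l')%N; exact: has_length_trans hl'.
Qed.

(** Each factor of [M / N] over [B] is some [B / P], whose length over [A] is
    [d P], and all its factors over [A] are [A / p] with [p = P `&` A]; so it
    contributes [d P] to the length at [p] and nothing elsewhere. *)
Lemma composition_factors_length (d : maxspec B -> nat) N M s :
  (forall P : maxspec B, maximal_ideal A (val P `&` A)) ->
  (forall P : maxspec B, has_length A (val P) B (d P)) ->
  composition_factors N M s -> forall p : maxspec A,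
  has_length (localization A (val p)) (locmod A (val p) N) (locmod A (val p) M)
    (\sum_(P <- s | val P `&` A == val p) d P).
Proof.
move=> cP dP + p; have mp := maxspecP p.
elim: s M => [|P s IH] M /=; first by move=> ->; rewrite big_nil; exact: has_length0.
move=> [L [/IH hL LM ann]]; rewrite big_cons; have mP := maxspecP P.
have [sL sM [LsubM nML] _] := LM.
case: eqP => [eP|neP]; last first.
  suff <- : locmod A (val p) L = locmod A (val p) M by [].
  apply: (locmod_eq sA mp) => //; first exact: submod_restr.
  have [t [Pt At] pt] : exists2 t, val P t /\ A t & ~ val p t.
    have [|t [[Pt At] pt]] := @nonsubset _ (val P `&` A) (val p).
      by move=> Pp; apply: neP; exact: maximal_sub_eq (cP P) mp Pp.
    by exists t.
  by exists t => // x Mx; apply: ann.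
rewrite addnC; apply: (has_length_trans hL).
apply: (locmod_length sA mp); last first.
  by move=> a x pa; have [Pa _] : (val P `&` A) a by [rewrite eP]; apply: ann.
have /(simple_quotientP sB) [_ [x Lx [eM h]]] := LM.
have [L0 LD LMu] := sL; have [B0 _ _] := submod_self sB.
have [P0 _ _] := maximal_submod mP.
have Mx : M x by rewrite eM; apply: addmul_gen.
have eL : addmul L x (val P) = L.
  apply: (addmul_id (submod_restr sL)) => // a Pa.
  by rewrite mulrC; apply: ann.
rewrite eM -[X in has_length _ X]eL; apply: (has_length_addmul sA) => //.
  exact: submod_restr.
move=> y By Ly; apply: contrapT => Py; apply: Lx.
have [b Bb Pb] := maximal_inv sB mP By Py.
have -> : x = (1 - b * y) * x + b * (x * y) by ring.
by apply: LD; [exact: ann | exact: LMu].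
Qed.

End Extension.

(** * Noetherian rings of dimension one *)

Section Noetherian.
Variables (K : fieldType) (A : set K).
Hypothesis sA : subring A.
Implicit Types (I J M p : set K) (a b x y : K).

Lemma submod_sum M (I : Type) (r : seq I) (F : I -> K) :
  submod A M -> (forall i, M (F i)) -> M (\sum_(i <- r) F i).
Proof.
by case=> M0 MD _ MF; elim/big_ind: _ => // i _; apply: MF.
Qed.

Lemma lspan_sub M (s : seq K) : submod A M ->
  (forall i : 'I_(size s), M s`_i) -> lspan A s `<=` M.
Proof.
move=> sM Ms _ [c Ac ->]; apply: submod_sum => // i.
by case: sM => _ _; apply.
Qed.

Lemma lspan_mem (s : seq K) (i : 'I_(size s)) : lspan A s s`_i.
Proof.
exists (fun j => (j == i)%:R).
  by move=> j; case: eqP => _; [exact: subring1 | exact: subring0].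
rewrite (bigD1 i) //= eqxx mul1r big1 ?addr0 // => j /negPf ->.
by rewrite mul0r.
Qed.

(** A counterexample would start a strictly ascending chain of ideals, whose
    union, being finitely generated, would already be one of its terms. *)
Lemma noetherian_ind (Q : set K -> Prop) : noetherian A ->
  (forall I, ideal A I -> (forall J, ideal A J -> I `<` J -> Q J) -> Q I) ->
  forall I, ideal A I -> Q I.
Proof.
move=> nA step I0 iI0; apply: contrapT => nQ0.
pose T := {I : set K | ideal A I /\ ~ Q I}.
have /choice [F hF] (t : T) : exists t' : T, sval t `<` sval t'.
  case: t => I [iI nQ] /=; apply: contrapT => H; apply: nQ; apply: step => // J iJ IJ.
  by apply: contrapT => nQJ; apply: H; exists (exist _ J (conj iJ nQJ)).
pose u n := sval (iter n F (exist _ I0 (conj iI0 nQ0))).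
have iu n : ideal A (u n) by rewrite /u; case: (iter _ _ _) => ? [].
have uS n : u n `<` u n.+1 by exact: hF.
have umono n m : (n <= m)%N -> u n `<=` u m.
  elim: m => [|m IH]; first by rewrite leqn0 => /eqP ->.
  rewrite leq_eqVlt => /predU1P[->//|/IH h].
  by apply: subset_trans h _; case: (uS m).
pose U := [set x | exists n, u n x].
have iU : ideal A U.
  split; last by move=> x [n unx]; case: (iu n) => _; apply.
  split.
  - by exists 0%N; case: (iu 0%N) => -[].
  - move=> x y [n unx] [m umy]; exists (maxn n m).
    case: (iu (maxn n m)) => -[_ uD _] _; apply: uD.
      exact: umono (leq_maxl _ _) _ unx.
    exact: umono (leq_maxr _ _) _ umy.
  - by move=> a x Aa [n unx]; exists n; case: (iu n) => -[_ _ uM] _; apply: uM.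
have [s es] := nA U iU.
have /choice [N hN] (i : 'I_(size s)) : exists n, u n s`_i.
  by have : U s`_i by rewrite es; exact: lspan_mem.
have UN : U `<=` u (\max_i N i)%N.
  rewrite es; apply: lspan_sub; first by case: (iu (\max_i N i)%N).
  by move=> i; apply: umono (hN i); exact: leq_bigmax.
have [_ nS] := uS (\max_i N i)%N; apply: nS => x ux; apply: UN.
by exists (\max_i N i).+1.
Qed.

Lemma ideal_eqA I : ideal A I -> I 1 -> I = A.
Proof.
move=> [[_ _ IM] IA] I1; rewrite eqEsubset; split=> // a Aa.
by rewrite -[a]mulr1; apply: IM.
Qed.

Lemma exists_maximal I : noetherian A -> ideal A I -> ~ I 1 ->
  exists2 m, maximal_ideal A m & I `<=` m.
Proof.
move=> nA; move: I.
apply: (noetherian_ind (Q := fun I => ~ I 1 -> exists2 m, maximal_ideal A m & I `<=` m)) => //.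
move=> I iI IH I1; case: (pselect (maximal_ideal A I)) => [mI|nI]; first by exists I.
have [J [iJ IJ JI JA]] : exists J, [/\ ideal A J, I `<=` J, J <> I & J <> A].
  apply: contrapT => H; apply: nI; split=> //.
    by apply/eqP => e; apply: I1; rewrite e; exact: subring1.
  move=> J iJ IJ; apply: contrapT => /not_orP [JI JA]; apply: H; by exists J.
have [||m mm Jm] := IH J iJ.
- by split=> // JI'; apply: JI; rewrite eqEsubset.
- by move=> J1; apply: JA; exact: ideal_eqA.
by exists m => //; exact: subset_trans Jm.
Qed.

Lemma maximal_is_prime p : maximal_ideal A p -> prime_ideal A p.
Proof.
move=> mp; have [ip _ _] := mp; split=> //.
  exact: (maximal_not1 mp).
move=> x y Ax Ay pxy; apply: contrapT => /not_orP [px py].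
exact: (maximal_prime sA mp Ax Ay px py pxy).
Qed.

Lemma zero_prime : prime_ideal A [set 0].
Proof.
split.
- by split; [exact: submod0 | move=> _ ->; exact: subring0].
- by move/eqP; rewrite oner_eq0.
- move=> x y _ _ /eqP; rewrite mulf_eq0 => /orP [] /eqP ->; [by left | by right].
Qed.

Definition nonzero_primes_maximal : Prop :=
  forall p, prime_ideal A p -> (exists2 x, p x & x != 0) -> maximal_ideal A p.

(** A nonzero prime [p] properly inside a maximal ideal [m] would give the
    chain [0 < p < m], of length two. *)
Lemma dim1_primes_maximal : noetherian A -> krull_dim A 1 ->
  nonzero_primes_maximal.
Proof.
move=> nA [_ nc] p pp [x px x0]; have [ip p1 _] := pp.
split=> //; first by apply/eqP => e; apply: p1; rewrite e; exact: subring1.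
move=> I iI pI; apply: contrapT => /not_orP [Ip IA].
have [|m mm Im] := exists_maximal nA iI; first by move/(ideal_eqA iI).
apply: nc; exists (fun i => if i is 0%N then [set 0] else if i is 1%N then p else m).
split=> [[|[|i]] _ //|[|[|//]] _ //=].
- exact: zero_prime.
- exact: maximal_is_prime.
- split; first by move=> _ ->; case: ip => -[].
  by move=> /(_ x px) /eqP; apply/negP.
- split; first exact: subset_trans Im.
  by move=> mp; apply: Ip; rewrite eqEsubset; split=> // y /Im /mp.
Qed.

Definition finite_length_mod : Prop :=
  forall a, A a -> a != 0 -> exists n, has_length A [set a * x | x in A] A n.

Lemma principal_ideal a : A a -> ideal A [set a * x | x in A].
Proof.
move=> Aa; split; first by apply: scale_submod; exact: submod_self.
by move=> _ [x Ax <-]; exact: subringM.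
Qed.

(** A non-prime proper ideal [I], say with [x y] in [I], is cut into
    [A / (I + x A)] and [(I + x A) / I], the latter being [A / (I : x)]; both
    [I + x A] and [I : x] are larger than [I]. *)
Lemma noetherian_finite_length : noetherian A -> nonzero_primes_maximal ->
  finite_length_mod.
Proof.
move=> nA pmax a Aa a0.
suff H : forall I, ideal A I -> (exists2 x, I x & x != 0) ->
    exists n, has_length A I A n.
  apply: H; first exact: principal_ideal.
  by exists a => //; exists 1; [exact: subring1 | rewrite mulr1].
apply: (noetherian_ind (Q := fun I => (exists2 x, I x & x != 0) ->
    exists n, has_length A I A n)) => // I iI IH [z Iz z0].
have [sI IA] := iI; have [I0 ID IM] := sI.
case: (pselect (I 1)) => [/(ideal_eqA iI) ->|I1].
  by exists 0%N; exact: has_length0.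
case: (pselect (prime_ideal A I)) => [pI|npI].
  exists 1%N; apply: has_length_simple; apply: maximal_simple => //.
  by apply: pmax => //; exists z.
have [x [y [Ax Ay Ixy Ix Iy]]] :
    exists x y, [/\ A x, A y, I (x * y), ~ I x & ~ I y].
  apply: contrapT => H; apply: npI; split=> // x y Ax Ay Ixy.
  by apply: contrapT => /not_orP [Ix Iy]; apply: H; exists x, y.
have A0 := subring0 sA.
have IJ : I `<=` addmul I x A by exact: sub_addmul.
have [|||n hn] := IH (addmul I x A).
- split; first by apply: addmul_submod => //; exact: submod_self.
  apply: (addmul_sub (submod_self sA)) => // b Ab; exact: subringM.
- by split=> // /(_ x (addmul_gen sA _ I0)).
- by exists z => //; exact: IJ.
pose C := [set c | A c /\ I (x * c)].
have IC : I `<=` C by move=> c Ic; split; [exact: IA | exact: IM].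
have [|||m hm] := IH C.
- split; last by move=> c [].
  split.
  + by split; rewrite ?mulr0.
  + move=> b c [Ab Ib] [Ac Ic]; split; first exact: subringD.
    by rewrite mulrDr; apply: ID.
  + move=> b c Ab [Ac Ic]; split; first exact: subringM.
    by rewrite mulrCA; apply: IM.
- by split=> // /(_ y (conj Ay Ixy)).
- by exists z => //; exact: IC.
have C0 : C 0 by split; rewrite ?mulr0.
exists (m + n)%N; apply: has_length_trans hn.
rewrite -[X in has_length _ X](addmul_id (z := x) (J := C) sI) //.
  by apply: (has_length_addmul sA).
by move=> c [].
Qed.

End Noetherian.

Section Conductor.
Variables (K : fieldType) (A : set K).
Hypothesis sA : subring A.

(** The product of the denominators of the generators serves for their span. *)
Lemma common_denominator (s : seq K) : fraction_field A ->
  exists d, [/\ A d, d != 0 & forall x, lspan A s x -> A (d * x)].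
Proof.
move=> fA; suff [d [Ad d0 h]] : exists d, [/\ A d, d != 0 & forall i, A (d * s`_i)].
  exists d; split=> // x.
  apply: (lspan_sub (A := A) (M := [set x | A (d * x)])); last by move=> i; apply: h.
  split=> /=.
  - by rewrite mulr0; exact: subring0.
  - by move=> y z Ay Az; rewrite mulrDr; exact: subringD.
  - by move=> a y Aa Ay; rewrite mulrCA; exact: subringM.
elim: s => [|x s [d [Ad d0 h]]].
  exists 1; split; [exact: subring1 | exact: oner_neq0|].
  by move=> i; rewrite nth_nil mulr0; exact: subring0.
have [a [b [Aa Ab b0 ->]]] := fA x.
exists (d * b); split; [exact: subringM | by rewrite mulf_neq0|].
case=> [|i] /=.
  suff -> : d * b * (a / b) = d * a by exact: subringM.
  by field.
by rewrite mulrAC mulrC; exact: subringM.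
Qed.

End Conductor.

(** * Orders *)

Section Orders.
Variables (K : fieldType) (A : set K).
Hypotheses (sA : subring A) (finA : finite_length_mod A).
Implicit Types (a b x y : K) (p : maxspec A).

Local Notation v p a := (len_mod_principal (localization A (val p)) a).

Lemma contraction_self p : val p `&` A = val p.
Proof. by rewrite setIidl //; exact: maximal_sub (maxspecP p). Qed.

Lemma principal_factors a : A a -> a != 0 ->
  exists s : seq (maxspec A), composition_factors [set a * x | x in A] A s.
Proof. by move=> Aa a0; have [n /(has_length_factors sA)] := finA Aa a0. Qed.

Lemma factors_count N M s : composition_factors N M s ->
  forall p, has_length (localization A (val p))
    (locmod A (val p) N) (locmod A (val p) M) (count_mem p s).
Proof.
move=> hs p.
have hc (q : maxspec A) : maximal_ideal A (val q `&` A).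
  by rewrite contraction_self; exact: maxspecP.
have h1 (q : maxspec A) : has_length A (val q) A 1.
  by apply/has_length_simple/maximal_simple/maxspecP.
have := composition_factors_length sA sA (@subset_refl _ A) hc h1 hs p.
rewrite (eq_bigl (pred1 p)); first by rewrite sum1_count.
by move=> q; rewrite contraction_self (inj_eq val_inj).
Qed.

Lemma factors_has_length a s : composition_factors [set a * x | x in A] A s ->
  forall p, has_length (localization A (val p))
    [set a * x | x in localization A (val p)] (localization A (val p))
    (count_mem p s).
Proof. by move=> /factors_count + p => /(_ p); rewrite locmod_scale. Qed.

Lemma factors_len a s : composition_factors [set a * x | x in A] A s ->
  forall p, v p a = count_mem p s.
Proof.
move=> hs p; apply: len_eq; last exact: factors_has_length.
exact: (loc_subring sA (maxspecP p)).
Qed.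

Lemma len_has_length a p : A a -> a != 0 ->
  has_length (localization A (val p))
    [set a * x | x in localization A (val p)] (localization A (val p)) (v p a).
Proof.
move=> Aa a0; have [s hs] := principal_factors Aa a0.
by rewrite (factors_len hs); exact: factors_has_length.
Qed.

(** The factor [a A / a b A] of [A / a b A] is isomorphic to [A / b A]. *)
Lemma lenM a b p : A a -> A b -> a != 0 -> b != 0 ->
  v p (a * b) = (v p a + v p b)%N.
Proof.
move=> Aa Ab a0 b0; have sAp := loc_subring sA (maxspecP p).
apply: len_eq => //; rewrite addnC.
apply: has_length_trans (len_has_length p Aa a0).
have := has_length_scale sAp a0 (scale_submod b (submod_self sAp)) (len_has_length p Ab b0).
rewrite image_comp (_ : _ \o _ = *%R (a * b)) //.
by apply/funext => x /=; rewrite mulrA.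
Qed.

(** A zero length would make [a] a unit in the localization. *)
Lemma len_gt0 a p : val p a -> a != 0 -> (0 < v p a)%N.
Proof.
move=> pa a0; have mp := maxspecP p; have Aa := maximal_sub mp pa.
have := len_has_length p Aa a0; case: (v p a) => // /has_length0P e.
have : localization A (val p) 1 by apply: (loc_sub sA mp); exact: subring1.
rewrite -{1}e => -[_ [b [s [Ab As ps ->]]] e1].
have s0 := maximal_neq0 mp ps; case: ps.
have -> : s = b * a by rewrite -[s]mul1r -e1 mulrA divfK // mulrC.
by case: (maximal_submod mp) => _ _; apply.
Qed.

Lemma ord_frac a b p : A a -> A b -> a != 0 -> b != 0 ->
  ord A (val p) (a / b) = (v p a)%:Z - (v p b)%:Z.
Proof.
move=> Aa Ab a0 b0; apply: xget_unique; first by exists a, b.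
move=> _ [a' [b' [[Aa' Ab'] a'0 b'0 e ->]]].
have e2 : a * b' = a' * b.
  have : a / b * (b * b') = a' / b' * (b * b') by rewrite e.
  have -> : a / b * (b * b') = a * b' by field.
  by have -> : a' / b' * (b * b') = a' * b by field.
have := congr1 (fun x => (v p x)%:Z) e2.
rewrite !lenM // !PoszD => h; apply/eqP; rewrite subr_eq addrAC eq_sym subr_eq.
by rewrite h.
Qed.

End Orders.

(** * Principal divisors *)

Section FreeGroup.
Variable T : choiceType.
Implicit Types (D : set T) (c : T -> int) (s : seq T).

Lemma coeff_sumU s p : coeff p (\sum_(q <- s) << q >> : {freeg T}) = (count_mem p s)%:Z.
Proof.
rewrite raddf_sum /=; elim: s => [|q s IH]; first by rewrite big_nil.
by rewrite big_cons IH coeffU mul1r /= PoszD; case: eqP.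
Qed.

(** Finiteness of the support matters: a sum over a set with infinitely many
    nonzero terms is [0] by convention. *)
Lemma coeff_fsum D c p : finite_set (D `&` [set q | c q != 0]) ->
  coeff p (\sum_(q \in D) << c q *g q >> : {freeg T}) = if p \in D then c p else 0.
Proof.
move=> fin.
have sE : D `&` (fun q => << c q *g q >> : {freeg T}) @^-1` [set~ 0]
    = D `&` [set q | c q != 0].
  rewrite eqEsubset; split=> q [Dq h]; split=> //=.
    by apply/eqP => e; apply: h; rewrite /= e freegU0.
  by move/eqP; rewrite freegU_eq0; apply/negP.
have memE q : q \in finite_support 0 D (fun q => << c q *g q >> : {freeg T})
    = (q \in D `&` [set q | c q != 0]).
  by rewrite in_finite_support sE // .
rewrite raddf_sum /=.
under eq_bigr do rewrite coeffU.
have [pin|pnin] := boolP (p \in finite_support 0 D (fun q => << c q *g q >> : {freeg T})).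
  rewrite (bigD1_seq p) //= eqxx mulr1 big1 ?addr0; last first.
    by move=> q /negPf ->; rewrite mulr0.
  by move: pin; rewrite memE inE => -[Dp _]; rewrite mem_set.
rewrite big1_seq.
  move: pnin; rewrite memE; case: ifP => // /set_mem Dp.
  rewrite notin_setE => /not_andP [//|/= /negP]; by rewrite negbK => /eqP.
move=> q /andP [_ qin]; case: eqP => [e|]; last by rewrite mulr0.
by rewrite e (negPf pnin) in qin.
Qed.

Lemma freegU_sum (I : Type) (r : seq I) (P : pred I) (F : I -> int) (p : T) :
  \sum_(i <- r | P i) << F i *g p >> = << \sum_(i <- r | P i) F i *g p >> :> {freeg T}.
Proof.
elim/big_rec2: _ => [|i x y _ ->]; first by rewrite freegU0.
by rewrite freegUD.
Qed.

End FreeGroup.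

Section PrincipalDivisors.
Variables (K : fieldType) (A : set K).
Hypotheses (sA : subring A) (finA : finite_length_mod A).

(** The support is finite, as only factors of [A / a A] and [A / b A] occur; so
    the sum defining the divisor has its intended value. *)
Lemma principal_divisor_frac a b sa sb : A a -> A b -> a != 0 -> b != 0 ->
  composition_factors [set a * x | x in A] A sa ->
  composition_factors [set b * x | x in A] A sb ->
  principal_divisor A (a / b) = \sum_(p <- sa) << p >> - \sum_(p <- sb) << p >>.
Proof.
move=> Aa Ab a0 b0 ha hb.
have oE (p : maxspec A) : ord A (val p) (a / b) = (count_mem p sa)%:Z - (count_mem p sb)%:Z.
  by rewrite (ord_frac sA finA) // (factors_len sA ha) (factors_len sA hb).
apply/eqP/freeg_eqP => p /=; rewrite coeffB !coeff_sumU coeff_fsum.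
  by rewrite in_setT oE.
apply: (sub_finite_set (B := [set` sa ++ sb])); last exact: finite_seq.
move=> q [_ /=]; rewrite oE mem_cat; apply: contraNT; rewrite negb_or.
by move=> /andP [/count_memPn -> /count_memPn ->].
Qed.

Hypothesis fracA : fraction_field A.

Lemma frac_neq0 x : x != 0 ->
  exists a b, [/\ A a, A b, a != 0, b != 0 & x = a / b].
Proof.
have [a [b [Aa Ab b0 ->]]] := fracA x => ab0; exists a, b; split=> //.
by apply: contraNneq ab0 => ->; rewrite mul0r.
Qed.

Lemma principal_divisor_div x y : x != 0 -> y != 0 ->
  principal_divisor A (x / y) = principal_divisor A x - principal_divisor A y.
Proof.
move=> /frac_neq0 [a [b [Aa Ab a0 b0 ->]]] /frac_neq0 [c [d [Ac Ad c0 d0 ->]]].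
have -> : a / b / (c / d) = (a * d) / (b * c) by field; rewrite b0 c0 d0.
have oE (p : maxspec A) : coeff p (principal_divisor A ((a * d) / (b * c))) =
   coeff p (principal_divisor A (a / b) - principal_divisor A (c / d)).
  have fac z : A z -> z != 0 -> exists s : seq (maxspec A),
      composition_factors [set z * x | x in A] A s by exact: principal_factors.
  have Aad := subringM sA Aa Ad; have Abc := subringM sA Ab Ac.
  have ad0 : a * d != 0 by rewrite mulf_neq0.
  have bc0 : b * c != 0 by rewrite mulf_neq0.
  have [sa ha] := fac a Aa a0; have [sb hb] := fac b Ab b0.
  have [sc hc] := fac c Ac c0; have [sd hd] := fac d Ad d0.
  have [sad had] := fac _ Aad ad0; have [sbc hbc] := fac _ Abc bc0.
  rewrite (principal_divisor_frac Aad Abc ad0 bc0 had hbc).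
  rewrite (principal_divisor_frac Aa Ab a0 b0 ha hb).
  rewrite (principal_divisor_frac Ac Ad c0 d0 hc hd).
  rewrite !coeffB !coeff_sumU -(factors_len sA had) -(factors_len sA hbc).
  rewrite !(lenM sA finA) // !PoszD (factors_len sA ha) (factors_len sA hb).
  by rewrite (factors_len sA hc) (factors_len sA hd); ring.
by apply/eqP/freeg_eqP.
Qed.

Lemma principal_subgroup : zmod_closed [in principal A].
Proof.
have A1 := subring1 sA; split.
  rewrite inE; exists 1; first by rewrite /= oner_neq0.
  by rewrite -[in LHS](divr1 1) principal_divisor_div ?oner_neq0 // subrr.
move=> _ _ /set_mem [x /= x0 <-] /set_mem [y /= y0 <-]; rewrite inE.
exists (x / y); first by rewrite /= mulf_neq0 // invr_eq0.
exact: principal_divisor_div.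
Qed.

End PrincipalDivisors.

(** * Quotient groups *)

Section Quotients.
Variables (G : zmodType) (S : set G).

Lemma classg_eq x y : zmod_closed [in S] -> (classg S x = classg S y) <-> S (x - y).
Proof.
move=> clS; have memE z : (z \in gen_subgroup S) <-> S z.
  split=> [/asboolP|Sz]; first by apply.
  by apply/asboolP => H _; apply.
rewrite -memE; split=> [e|h].
  by rewrite (Quotient.idealrBE (gen_subgroup S : zmodClosed G)); apply/eqP.
by apply/eqP; rewrite -[_ == _](Quotient.idealrBE (gen_subgroup S : zmodClosed G)).
Qed.

Lemma classgB x y : classg S (x - y) = classg S x - classg S y.
Proof. exact: (raddfB (\pi_(Quotient.quot (gen_subgroup S : zmodClosed G)))%qT). Qed.

Lemma reprgK u : classg S (reprg u) = u.
Proof. exact: reprK. Qed.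

(** The first isomorphism theorem. *)
Lemma quotg_isom (H : zmodType) (h : {additive G -> H}) :
  (forall x, h x = 0 <-> S x) -> (forall y, exists x, h x = y) ->
  isomg (quotg S) H.
Proof.
move=> hS hsurj.
have clS : zmod_closed [in S].
  split; first by rewrite inE; apply/hS; rewrite raddf0.
  move=> x y /set_mem/hS hx /set_mem/hS hy; rewrite inE; apply/hS.
  by rewrite raddfB hx hy subrr.
have hrepr x : h (reprg (classg S x)) = h x.
  apply/eqP; rewrite -subr_eq0 -raddfB; apply/eqP/hS/classg_eq => //.
  exact: reprgK.
have addh : zmod_morphism (fun u : quotg S => h (reprg u)).
  move=> u v; rewrite -{1}(reprgK u) -{1}(reprgK v) -classgB hrepr.
  by rewrite raddfB.
pose F : {additive quotg S -> H} := HB.pack (fun u : quotg S => h (reprg u))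
  (GRing.isZmodMorphism.Build _ _ _ addh).
exists F.
have [g hg] := choice hsurj.
exists (fun y => classg S (g y)) => [u|y] /=.
  rewrite -[RHS]reprgK; apply/classg_eq => //; apply/hS.
  by rewrite raddfB hg subrr.
by rewrite hrepr.
Qed.

End Quotients.

(** * Residue degrees *)

Section Snoc.
Variables (T : Type) (n : nat).

Definition snoc (b : 'I_n -> T) (x : T) (j : 'I_n.+1) : T :=
  if unlift ord_max j is Some k then b k else x.

Lemma snoc_widen b x k : snoc b x (widen_ord (leqnSn n) k) = b k.
Proof.
rewrite /snoc (_ : widen_ord _ _ = lift ord_max k) ?liftK //.
by apply/val_inj; rewrite /= /bump leqNgt ltn_ord.
Qed.

Lemma snoc_max b x : snoc b x ord_max = x.
Proof. by rewrite /snoc unlift_none. Qed.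

Lemma snoc_all (Q : T -> Prop) b x : (forall i, Q (b i)) -> Q x ->
  forall j, Q (snoc b x j).
Proof. by move=> Qb Qx j; rewrite /snoc; case: unlift. Qed.

(** Case analysis matching [big_ord_recr]. *)
Lemma ord_snocP (Q : 'I_n.+1 -> Prop) :
  (forall k, Q (widen_ord (leqnSn n) k)) -> Q ord_max -> forall j, Q j.
Proof.
move=> Qw Qm j; case: (unliftP ord_max j) => [k ->|-> //].
suff -> : lift ord_max k = widen_ord (leqnSn n) k by exact: Qw.
by apply/val_inj; rewrite /= /bump leqNgt ltn_ord.
Qed.

End Snoc.

Section ResidueDegree.
Variables (K : fieldType) (A B : set K).
Hypotheses (sA : subring A) (sB : subring B) (AB : A `<=` B).
Variable P : maxspec B.
Hypothesis cP : maximal_ideal A (val P `&` A).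

Let mP : maximal_ideal B (val P). Proof. exact: maxspecP. Qed.
Let sP : submod A (val P). Proof. exact (submod_restr AB (maximal_submod mP)). Qed.

(** The independence clause of [residue_basis]. *)
Definition residue_free n (b : 'I_n -> K) : Prop :=
  forall c : 'I_n -> K, (forall i, A (c i)) ->
    val P (\sum_i c i * b i) -> forall i, (val P `&` A) (c i).

Definition residue_span n (b : 'I_n -> K) : set K :=
  [set y | exists2 c : 'I_n -> K, (forall i, A (c i)) & val P (y - \sum_i c i * b i)].

Lemma residue_span_submod n (b : 'I_n -> K) : submod A (residue_span b).
Proof.
have [P0 PD PM] := sP; split.
- exists (fun=> 0); first by move=> _; exact: subring0.
  by rewrite big1 ?subrr // => i _; rewrite mul0r.
- move=> x y [c Ac Pc] [c' Ac' Pc']; exists (fun i => c i + c' i).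
    by move=> i; exact: subringD.
  under eq_bigr do rewrite mulrDl.
  by rewrite big_split opprD addrACA; exact: PD.
- move=> a x Aa [c Ac Pc]; exists (fun i => a * c i).
    by move=> i; exact: subringM.
  under eq_bigr do rewrite -mulrA.
  by rewrite -mulr_sumr -mulrBr; exact: PM.
Qed.

Lemma residue_span_sub n (b : 'I_n -> K) (L : set K) : submod A L ->
  val P `<=` L -> (forall i, L (b i)) -> residue_span b `<=` L.
Proof.
move=> sL PL Lb y [c Ac Pc]; have [_ LD LM] := sL.
rewrite -[y](subrK (\sum_i c i * b i)); apply: LD; first exact: PL.
by apply: (submod_sum _ sL) => i; exact: LM.
Qed.

Lemma sub_residue_span n (b : 'I_n -> K) : val P `<=` residue_span b.
Proof.
move=> y Py; exists (fun=> 0); first by move=> _; exact: subring0.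
by rewrite big1 ?subr0 // => i _; rewrite mul0r.
Qed.

Lemma residue_span_gen n (b : 'I_n -> K) i : residue_span b (b i).
Proof.
exists (fun j => (j == i)%:R).
  by move=> j; case: eqP => _; [exact: subring1 | exact: subring0].
rewrite (bigD1 i) //= eqxx mul1r big1 ?addr0 ?subrr.
  by case: sP.
by move=> j /negPf ->; rewrite mul0r.
Qed.

Lemma residue_spanS n (b : 'I_n.+1 -> K) :
  residue_span b = addmul (residue_span (fun i => b (widen_ord (leqnSn n) i))) (b ord_max) A.
Proof.
rewrite eqEsubset; split=> [y [c Ac Pc]|].
  exists (y - c ord_max * b ord_max), (c ord_max); split=> //; last by ring.
  exists (fun i => c (widen_ord (leqnSn n) i)) => //.
  by move: Pc; rewrite big_ord_recr /= opprD addrAC addrA.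
have sb := residue_span_submod b; have [_ _ bM] := sb.
apply: (addmul_sub sb).
  apply: (residue_span_sub sb); first exact: sub_residue_span.
  by move=> i; exact: (residue_span_gen b).
by move=> a Aa; rewrite mulrC; apply: bM => //; exact: residue_span_gen.
Qed.

Lemma residue_span0 (b : 'I_0 -> K) : residue_span b = val P.
Proof.
rewrite eqEsubset; split; last exact: sub_residue_span.
by move=> y [c _]; rewrite big_ord0 subr0.
Qed.

Lemma maximal_contraction_inv a : A a -> ~ val P a ->
  exists2 c, A c & val P (1 - c * a).
Proof.
move=> Aa Pa; have [|c Ac []] := maximal_inv sA cP Aa; first by case.
by exists c.
Qed.

(** Adding the [b i] one by one to [P] gives a composition series: each step is
    cyclic and killed by the maximal ideal [P `&` A], and it is proper by
    independence. *)
Lemma residue_free_length n (b : 'I_n -> K) : (forall i, B (b i)) ->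
  residue_free b -> has_length A (val P) (residue_span b) n.
Proof.
elim: n b => [|n IH] b Bb fb; first by rewrite residue_span0; exact: has_length0.
pose b' i := b (widen_ord (leqnSn n) i).
have fb' : residue_free b'.
  move=> c Ac Pc i.
  have := fb (snoc c 0) _ _ (widen_ord (leqnSn n) i); rewrite snoc_widen; apply.
    by apply: snoc_all => //; exact: subring0.
  rewrite big_ord_recr /= snoc_max mul0r addr0.
  by under eq_bigr do rewrite snoc_widen.
have sb' := residue_span_submod b'.
apply: (has_lengthS (IH b' (fun=> Bb _) fb')).
apply/(simple_quotientP sA); split=> //; exists (b ord_max).
  move=> [c Ac Pc].
  have [] := fb (snoc (fun k => - c k) 1) _ _ ord_max.
  - by apply: snoc_all => [k|]; [exact: subringN | exact: subring1].
  - rewrite big_ord_recr /= snoc_max mul1r addrC.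
    under eq_bigr do rewrite snoc_widen mulNr.
    by rewrite sumrN.
  - by rewrite snoc_max => /(maximal_not1 mP).
split; first exact: residue_spanS.
have PB y : val P y -> val P (y * b ord_max).
  by rewrite mulrC; case: (maximal_submod mP) => _ _; apply; exact: Bb.
move=> a Aa; case: (pselect (val P a)) => [Pa|Pa]; [left | right].
  by apply: sub_residue_span; exact: PB.
have [c Ac Pc] := maximal_contraction_inv Aa Pa; exists c => //.
apply: sub_residue_span; suff -> : b ord_max - c * (a * b ord_max) =
  (1 - c * a) * b ord_max by exact: PB.
by ring.
Qed.

(** Conversely, picking a new element in each step of a composition series
    gives independent elements. *)
Lemma length_residue_free N n : has_length A (val P) N n -> N `<=` B ->
  exists b : 'I_n -> K, [/\ forall i, B (b i), residue_free b & residue_span b = N].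
Proof.
elim: n N => [|n IH] N.
  move/has_length0P => <- _; exists (fun=> 0); split; [by case| |exact: residue_span0].
  by move=> c _ _ [].
case/has_lengthSP => L hL LN NB; have [_ _ [LsubN _] _] := LN.
have [b [Bb fb eL]] := IH L hL (subset_trans LsubN NB).
have PL := has_length_sub hL.
have /(simple_quotientP sA) [sL [x Lx [eN hx]]] := LN.
have [L0 LD LM] := sL.
have Bx : B x by apply: NB; rewrite eN; apply: addmul_gen.
exists (snoc b x); split.
- exact: snoc_all.
- move=> c Ac; rewrite big_ord_recr /= snoc_max.
  under eq_bigr do rewrite snoc_widen.
  set S := \sum_i _ => PS.
  have LS : L S.
    rewrite -eL; apply: (submod_sum _ (residue_span_submod b)) => i.
    by case: (residue_span_submod b) => _ _; apply => //; exact: residue_span_gen.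
  have Lcx : L (c ord_max * x).
    suff -> : c ord_max * x = (S + c ord_max * x) - S.
      by apply: (submodB sA) => //; exact: PL.
    by ring.
  have Pc : val P (c ord_max).
    apply: contrapT => Pc; apply: Lx.
    have [e Ae Pe] := maximal_contraction_inv (Ac ord_max) Pc.
    have -> : x = x * (1 - e * c ord_max) + e * (c ord_max * x) by ring.
    apply: LD; last exact: LM.
    by apply: PL; case: (maximal_submod mP) => _ _; apply.
  have Pcx : val P (c ord_max * x).
    by rewrite mulrC; case: (maximal_submod mP) => _ _; apply.
  have PS' : val P S.
    suff -> : S = (S + c ord_max * x) - c ord_max * x by apply: (submodB sA).
    by ring.
  apply: ord_snocP => [k|]; last by split.
  exact: (fb (fun i => c (widen_ord (leqnSn n) i)) _ PS' k).
- rewrite residue_spanS snoc_max eN -eL; congr (addmul (residue_span _) _ _).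
  by apply/funext => k; rewrite snoc_widen.
Qed.

(** Bases of [B / P] over the residue field of [A] and composition series of
    [B / P] over [A] yield each other, so a basis exists and its size is unique. *)
Lemma residue_degree_length n : has_length A (val P) B n -> residue_degree A P = n.
Proof.
move=> hn; apply: xget_unique => /=.
  have [b [Bb fb eb]] := length_residue_free hn (@subset_refl _ B).
  by exists b; split=> // x Bx; have : residue_span b x by rewrite eb.
move=> m [b [Bb sb fb]].
suff eB : residue_span b = B.
  by have := residue_free_length Bb fb; rewrite eB => /(has_length_uniq sA); apply.
rewrite eqEsubset; split=> [|x Bx]; last exact: sb.
apply: residue_span_sub => //; last exact: maximal_sub.
exact (submod_restr AB (submod_self sB)).
Qed.

End ResidueDegree.

(** * Finite extensions and the push-forward of principal divisors *)

Section PushforwardMorphism.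
Variables (K : fieldType) (A B : set K).

Lemma pushforward_is_zmod_morphism : zmod_morphism (pushforward A B).
Proof. exact: lift_is_additive. Qed.

HB.instance Definition _ := GRing.isZmodMorphism.Build (Div B) (Div A)
  (pushforward A B) pushforward_is_zmod_morphism.

End PushforwardMorphism.

Section FiniteExtension.
Variables (K : fieldType) (A B : set K).
Hypotheses (sA : subring A) (sB : subring B) (AB : A `<=` B).
Hypotheses (fracA : fraction_field A) (finA : finite_length_mod A).
Hypothesis pmaxA : nonzero_primes_maximal A.
(* [d] is a conductor element; [z] witnesses that [A] is not a field. *)
Variable d : K.
Hypotheses (Ad : A d) (d0 : d != 0) (dB : forall x, B x -> A (d * x)).
Variable z : K.
Hypotheses (Az : A z) (z0 : z != 0) (nAz : ~ A z^-1).

Implicit Types (p : maxspec A) (P : maxspec B).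

(** Multiplication by [d] maps [B] into [A], so a nonzero [x] in [N] gives
    [d x A <= N <= M <= d^-1 A], and [d^-1 A / d x A] has finite length. *)
Lemma sandwich_length (N M : set K) x : submod A N -> submod A M -> N x -> x != 0 ->
  N `<=` M -> M `<=` B -> exists n, has_length A N M n.
Proof.
move=> sN sM Nx x0 NM MB; have sAA := submod_self sA.
have Adx : A (d * x) by apply/dB/MB/NM.
have [n hn] := finA Adx (mulf_neq0 d0 x0).
have [m hm] := finA Ad d0.
have := has_length_scale sA (invr_neq0 d0) (scale_submod d sAA) hm.
rewrite image_comp (_ : _ \o _ = id); last first.
  by apply/funext => y /=; rewrite mulrA mulVf // mul1r.
rewrite image_id => hm'.
have h := has_length_trans hn hm'.
have dxN : [set d * x * a | a in A] `<=` N.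
  move=> _ [a Aa <-]; rewrite (_ : _ * a = (d * a) * x); last by ring.
  by case: sN => _ _; apply => //; exact: subringM.
have Md : M `<=` [set d^-1 * a | a in A].
  by move=> y /MB/dB Ady; exists (d * y) => //; rewrite mulrA mulVf // mul1r.
have [k [l [_ hl _]]] := has_length_split sA sN h dxN (subset_trans NM Md).
have [k' [l' [hk' _ _]]] := has_length_split sA sM hl NM Md.
by exists k'.
Qed.

(** [B / a B] has finite length already over the smaller ring [A]. *)
Lemma extension_finite_length : finite_length_mod B.
Proof.
move=> a Ba a0; have sBB := submod_self sB; have sa := scale_submod a sBB.
have [n hn] : exists n, has_length A [set a * x | x in B] B n.
  apply: (sandwich_length (x := a)) => //.
  - exact (submod_restr AB sa).
  - exact (submod_restr AB sBB).
  - by exists 1; [exact: subring1 | rewrite mulr1].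
  - by move=> _ [y By <-]; exact: subringM.
exact (has_length_extend sA AB sa sBB hn).
Qed.

Lemma extension_fraction_field : fraction_field B.
Proof. by move=> x; have [a [b [/AB Ba /AB Bb b0 e]]] := fracA x; exists a, b. Qed.

(** An inverse [b] of [d z] in [B] would make [d b] an inverse of [z] in [A]. *)
Lemma maxspec_nonzero P : exists2 x, val P x & x != 0.
Proof.
apply: (maximal_nonzero sB (z := d * z) (maxspecP P)).
- by apply: (subringM sB); exact: AB.
- exact: mulf_neq0.
- by move/dB; rewrite invfM mulrA divff // mul1r.
Qed.

(** The contraction is a prime ideal, nonzero as it contains [d x] for every
    [x] in [P]. *)
Lemma contraction_maximal P : maximal_ideal A (val P `&` A).
Proof.
have mP := maxspecP P; have [x Px x0] := maxspec_nonzero P.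
have [P0 PD PM] := maximal_submod mP.
apply: pmaxA; last first.
  exists (d * x); last exact: mulf_neq0.
  split; first by apply: PM => //; exact: AB.
  by apply: dB; exact: (maximal_sub mP).
split.
- split; last by move=> y [].
  apply: submodI; last exact: submod_self.
  exact (submod_restr AB (maximal_submod mP)).
- by case=> /(maximal_not1 mP).
- move=> a b Aa Ab [Pab _]; apply: contrapT => /not_orP [Pa Pb].
  apply: (maximal_prime sB mP (AB Aa) (AB Ab) _ _ Pab) => ?; [exact: Pa|exact: Pb].
Qed.

Definition contraction P : maxspec A := SigSub (mem_set (contraction_maximal P)).

Lemma contractionE P p : (contraction P == p) = (val P `&` A == val p).
Proof. by rewrite -(inj_eq val_inj). Qed.

Lemma contraction_over P p : contraction P = p <-> maxspec_over B p P.
Proof. by split=> [<- //|h]; apply/eqP; rewrite contractionE; apply/eqP. Qed.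

Lemma residue_length P : has_length A (val P) B (residue_degree A P).
Proof.
have mP := maxspecP P; have [x Px x0] := maxspec_nonzero P.
have [n hn] : exists n, has_length A (val P) B n.
  apply: (sandwich_length (x := x)) => //.
  - exact (submod_restr AB (maximal_submod mP)).
  - exact (submod_restr AB (submod_self sB)).
  - exact: maximal_sub.
by rewrite (residue_degree_length sA sB AB (contraction_maximal P) hn).
Qed.

Lemma residue_degree_gt0 P : (0 < residue_degree A P)%N.
Proof.
have := residue_length P; case: (residue_degree A P) => // /has_length0P e.
by have [_ /eqP] := maxspecP P.
Qed.

Local Notation v p a := (len_mod_principal (localization A (val p)) a).

(** At [p], both [a A <= A <= B] and [a A <= a B <= B] compute the length of
    [B / a A].  As [B / A] and [a B / a A] have the same finite length, so have
    [A / a A] and [B / a B]; and the latter is read off a composition series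
    over [B]. *)
Lemma len_extension a s : A a -> a != 0 ->
  composition_factors [set a * x | x in B] B s -> forall p,
  v p a = (\sum_(P <- s | contraction P == p) residue_degree A P)%N.
Proof.
move=> Aa a0 hs p; have mp := maxspecP p; have sAp := loc_subring sA mp.
have := composition_factors_length sA sB AB contraction_maximal residue_length hs p.
rewrite locmod_scale; under eq_bigl do rewrite -contractionE.
set m := (\sum_(P <- s | _) _)%N => hm.
have sAB := submod_restr AB (submod_self sB).
have [k hk] : exists k, has_length A A B k.
  apply: (sandwich_length (x := 1)) => //; [exact: submod_self | exact: subring1 |].
  exact: oner_neq0.
have [t ht] := has_length_factors sA hk.
have hl := factors_count sA ht p.
have := has_length_scale sAp a0 (submod_self sAp) hl.
have h1 := len_has_length sA finA p Aa a0.
move=> h2; have := has_length_trans h2 hm.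
by move=> /(has_length_uniq sAp (has_length_trans h1 hl)) /eqP; rewrite addnC eqn_add2l => /eqP.
Qed.

(** A nonzero [x] in [p] has positive order at [p], and this order is a sum over
    the ideals above [p], which therefore exist. *)
Lemma lying_over p : exists P, maxspec_over B p P.
Proof.
have [x px x0] := maximal_nonzero sA (maxspecP p) Az z0 nAz.
have Ax := maximal_sub (maxspecP p) px.
have [s hs] := principal_factors sB extension_finite_length (AB Ax) x0.
have := len_gt0 sA finA px x0; rewrite (len_extension Ax x0 hs).
rewrite lt0n => /eqP h; apply: contrapT => H; apply: h.
rewrite big1 // => P /eqP/contraction_over PP; by case: H; exists P.
Qed.
(** All ideals above [p] contain a common nonzero [y] in [p], hence occur among
    the finitely many composition factors of [B / y B]. *)
Lemma maxspec_over_finite p : finite_set (maxspec_over B p).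
Proof.
have [P0 /contraction_over P0p] := lying_over p.
have [x P0x x0] := maxspec_nonzero P0.
have px : val p (d * x).
  rewrite -P0p; split; last by apply: dB; exact: (maximal_sub (maxspecP P0)).
  by case: (maximal_submod (maxspecP P0)) => _ _; apply => //; exact: AB.
have Bdx : B (d * x) by apply/AB/(maximal_sub (maxspecP p)).
have dx0 : d * x != 0 by rewrite mulf_neq0.
have [s hs] := principal_factors sB extension_finite_length Bdx dx0.
apply: (sub_finite_set (B := [set` s])); last exact: finite_seq.
move=> P /= PP; have Pdx : val P (d * x) by move: px; rewrite -PP => -[].
have := len_gt0 sB extension_finite_length Pdx dx0.
by rewrite (factors_len sB hs) -has_count has_pred1.
Qed.

Lemma finite_maxspec_containing x : A x -> x != 0 ->
  finite_set [set p : maxspec A | val p x].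
Proof.
move=> Ax x0; have [s hs] := principal_factors sA finA Ax x0.
apply: (sub_finite_set (B := [set` s])); last exact: finite_seq.
move=> p /= px; have := len_gt0 sA finA px x0.
by rewrite (factors_len sA hs) -has_count has_pred1.
Qed.

Lemma gcd_degreeE p (r : seq (maxspec B)) : uniq r -> [set` r] = maxspec_over B p ->
  gcd_degree B p = \big[gcdn/0%N]_(P <- r) residue_degree A P.
Proof. by move=> ur e; rewrite /gcd_degree -e -fsbig_seq. Qed.

Lemma gcd_degree_dvd p P : maxspec_over B p P -> (gcd_degree B p %| residue_degree A P)%N.
Proof.
have /finite_seqP [r er] := maxspec_over_finite p.
rewrite (@gcd_degreeE p (undup r)) ?undup_uniq //; last first.
  by rewrite er; apply/seteqP; split=> Q /=; rewrite mem_undup.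
rewrite er /= -mem_undup => Pr.
by rewrite (big_rem P) //= dvdn_gcdl.
Qed.

(** As [d] is invertible modulo [p] and [d x] lies in [A], every [x] in [B] is
    congruent to an element of [A] modulo each [P] above [p]: the residue degree
    is [1], with basis [1]. *)
Lemma gcd_degree1 p : ~ val p d -> gcd_degree B p = 1%N.
Proof.
move=> pd; have [P PP] := lying_over p.
have mp := maxspecP p; have mP := maxspecP P.
have [P0 PD PM] := maximal_submod mP.
have [c Ac pc] := maximal_inv sA mp Ad pd.
have pP x : val p x -> val P x by rewrite -PP => -[].
suff deg1 : residue_degree A P = 1%N.
  by have := gcd_degree_dvd PP; rewrite deg1 dvdn1 => /eqP.
have A1 := subring1 sA.
apply: (residue_degree_length sA sB AB (contraction_maximal P)).
have := residue_free_length sA AB (contraction_maximal P) (n := 1) (b := fun=> 1).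
rewrite (_ : residue_span _ _ _ = B).
  apply; first by move=> _; exact: AB.
  move=> e Ae Pe i; move: Pe; rewrite big_ord1 mulr1 (ord1 i) => Pe; split=> //.
rewrite eqEsubset; split=> [|x Bx].
  apply: residue_span_sub => //; first exact (submod_restr AB (submod_self sB)).
    exact: (maximal_sub mP).
  by move=> _; exact: AB.
exists (fun=> c * (d * x)); first by move=> _; apply: subringM => //; exact: dB.
rewrite big_ord1 mulr1 (_ : _ - _ = x * (1 - c * d)); last by ring.
by apply: PM => //; exact: pP.
Qed.

(** Write [1] as a sum of products of elements of [p] and [J].  Some product
    [x y] is outside [p], and then any [a] in [p] is [x (y a) / (x y)] with
    [y a] in [A]: locally at [p], the ideal [p] is generated by [x]. *)
Lemma invertible_local_generator p : invertible_ideal A (val p) ->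
  exists x, [/\ val p x, x != 0 & v p x = 1%N].
Proof.
move=> [J fJ epJ]; have mp := maxspecP p; have [sJ _ _] := fJ.
have sAp := loc_subring sA mp.
have [x [y [px Jy pxy]]] : exists x y, [/\ val p x, J y & ~ val p (x * y)].
  apply: contrapT => H; apply: (maximal_not1 mp).
  have [s hs ->] : prodmod (val p) J 1 by rewrite epJ; exact: subring1.
  have [p0 pD _] := maximal_submod mp.
  rewrite big_seq; elim/big_ind: _ => // u us.
  by apply: contrapT => pu; apply: H; exists u.1, u.2; have [] := hs u us.
have x0 : x != 0.
  apply/eqP => e; apply: pxy; rewrite e mul0r.
  by case: (maximal_submod mp).
have pJA a b : val p a -> J b -> A (a * b).
  move=> pa Jb; suff : prodmod (val p) J (a * b) by rewrite epJ.
  exists [:: (a, b)]; last by rewrite big_seq1.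
  by move=> u; rewrite inE => /eqP ->.
have xy0 := maximal_neq0 mp pxy.
have Ax := maximal_sub mp px.
exists x; split=> //; apply: (len_eq sAp).
apply: has_length_simple; apply/(simple_quotientP sAp).
split; first by apply: scale_submod; exact: submod_self.
have pxA a : val p a -> [set x * b | b in localization A (val p)] a.
  move=> pa; exists (y * a / (x * y)); last first.
    have y0 : y != 0 by apply: contraNneq xy0 => ->; rewrite mulr0.
    by field; rewrite ?x0 ?y0.
  by exists (y * a), (x * y); split=> //; [rewrite mulrC; exact: pJA | exact: pJA].
have sxA : submod (localization A (val p)) [set x * b | b in localization A (val p)].
  by apply: scale_submod; exact: submod_self.
have [_ _ xAM] := sxA.
have loc1 a : A a -> localization A (val p) a by exact: (loc_sub sA mp).
exists 1.
  move=> [_ [b [s [Ab As ps ->]]] e]; have s0 := maximal_neq0 mp ps; case: ps.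
  have -> : s = b * x by rewrite -[s]mul1r -e mulrA divfK // mulrC.
  by case: (maximal_submod mp) => _ _; apply.
split.
  rewrite eqEsubset; split=> [a Apa|].
    exists 0, a; split=> //; last by rewrite add0r mul1r.
    by case: sxA.
  apply: (addmul_sub (submod_self sAp)).
    by move=> _ [b Ab <-]; apply: (subringM sAp) => //; exact: loc1.
  by move=> a; rewrite mul1r.
move=> _ [a [s [Aa As ps ->]]]; rewrite mulr1.
have s0 := maximal_neq0 mp ps.
case: (pselect (val p a)) => pa; [left | right].
  by rewrite mulrC; apply: xAM; [exact: (loc_inv sA) | exact: pxA].
have a0 := maximal_neq0 mp pa.
exists (s / a); first by exists s, a.
rewrite (_ : 1 - _ = 0); last by field; rewrite ?a0 ?s0.
by case: sxA.
Qed.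

(** An element [x] of order [1] at [p] satisfies
    [1 = \sum_P (residue_degree A P) * ord_P x], where every [P] above [p]
    contributes at least [1]. *)
Lemma invertible_over p : invertible_ideal A (val p) ->
  exists2 P, maxspec_over B p = [set P] & residue_degree A P = 1%N.
Proof.
move=> /invertible_local_generator [x [px x0 vx]].
have Ax := maximal_sub (maxspecP p) px.
have [s hs] := principal_factors sB extension_finite_length (AB Ax) x0.
have ins P : maxspec_over B p P -> P \in s.
  move=> PP; have Px : val P x by move: px; rewrite -PP => -[].
  have := len_gt0 sB extension_finite_length Px x0.
  by rewrite (factors_len sB hs) -has_count has_pred1.
have := len_extension Ax x0 hs p; rewrite vx => e1.
have [P PP] := lying_over p.
have cP Q : maxspec_over B p Q -> contraction Q == p by move/contraction_over/eqP.
move: e1; rewrite (big_rem P (ins P PP)) cP //= => e1.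
have d1 := residue_degree_gt0 P.
have [dP1 rest] : residue_degree A P = 1%N /\
    (\sum_(Q <- rem P s | contraction Q == p) residue_degree A Q = 0)%N.
  by move: e1 d1; case: residue_degree => [|[|n]] //; rewrite add1n => -[<-].
exists P => //; rewrite eqEsubset; split=> [Q QP|_ -> //] /=.
apply/eqP; apply: contraT => QnP.
have Qr : Q \in rem P s.
  have := ins Q QP; rewrite (perm_mem (perm_to_rem (ins P PP))) inE.
  by rewrite (negPf QnP).
move: rest; rewrite (big_rem Q Qr) cP //= => /eqP; rewrite addn_eq0.
by rewrite eqn0Ngt residue_degree_gt0.
Qed.

Lemma pushforwardU k P : pushforward A B << k *g P >> =
  << k * (residue_degree A P)%:Z *g contraction P >>.
Proof.
rewrite /pushforward liftU.
have -> : insub (val P `&` A) = Some (contraction P).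
  by rewrite insubT; [rewrite inE; exact: contraction_maximal | move=> h; congr Some; exact/val_inj].
by apply/eqP/freeg_eqP => p; rewrite coeffZ !coeffU mulrA.
Qed.

Lemma coeff_pushforward D p : coeff p (pushforward A B D) =
  \sum_(P \in maxspec_over B p) coeff P D * (residue_degree A P)%:Z.
Proof.
have eP : maxspec_over B p = [set` (fun P => contraction P == p) : {pred maxspec B}].
  rewrite eqEsubset; split=> P.
    by move=> /contraction_over/eqP.
  by move=> /eqP/contraction_over.
rewrite eP -(bigfs _ (r := dom D)) ?uniq_dom //; last first.
  by move=> P _ /coeff_outdom ->; rewrite mul0r.
rewrite -{1}(freeg_sumE D) !raddf_sum /= [RHS]big_mkcond /=.
apply: eq_bigr => P _; rewrite pushforwardU coeffU.
by case: eqP => _; rewrite ?mulr1 ?mulr0.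
Qed.

Lemma pushforward_principal x : x != 0 ->
  pushforward A B (principal_divisor B x) = principal_divisor A x.
Proof.
move=> x0; have finB := extension_finite_length.
have [a [b [Aa Ab a0 b0 ->]]] := frac_neq0 fracA x0.
have [sa ha] := principal_factors sB finB (AB Aa) a0.
have [sb hb] := principal_factors sB finB (AB Ab) b0.
have [ta hta] := principal_factors sA finA Aa a0.
have [tb htb] := principal_factors sA finA Ab b0.
rewrite (principal_divisor_frac sB finB (AB Aa) (AB Ab) a0 b0 ha hb).
rewrite (principal_divisor_frac sA finA Aa Ab a0 b0 hta htb).
have key c s t : A c -> c != 0 ->
    composition_factors [set c * x | x in B] B s ->
    composition_factors [set c * x | x in A] A t ->
    pushforward A B (\sum_(P <- s) << P >>) = \sum_(p <- t) << p >>.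
  move=> Ac c0 hs ht; apply/eqP/freeg_eqP => p /=.
  rewrite coeff_sumU -(factors_len sA ht) (len_extension Ac c0 hs) !raddf_sum /=.
  rewrite [RHS]big_mkcond /=; apply: eq_bigr => P _.
  rewrite pushforwardU coeffU mul1r.
  by case: eqP => _; rewrite ?mulr1 ?mulr0.
by rewrite raddfB /= (key a sa ta) // (key b sb tb).
Qed.

(** ** Image, kernel and cokernel *)

Local Notation f := (pushforward A B).
Local Notation deg P := (residue_degree A P).
Local Notation g := (gcd_degree (A := A) B).

Lemma maxspec_over_seq p : exists2 r : seq (maxspec B), uniq r & maxspec_over B p = [set` r].
Proof.
have /finite_seqP [r er] := maxspec_over_finite p.
exists (undup r); first exact: undup_uniq.
by rewrite er; apply/seteqP; split=> Q /=; rewrite mem_undup.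
Qed.

Lemma gcd_degree_invertible p : invertible_ideal A (val p) -> g p = 1%N.
Proof.
move=> /invertible_over [P PP d1].
have := gcd_degree_dvd (p := p) (P := P); rewrite PP d1 dvdn1.
by move=> /(_ erefl) /eqP.
Qed.

(** Bezout's identity combines the residue degrees over [p] into [g p]. *)
Lemma pushforward_gcd p : exists X : Div B, f X = << (g p)%:Z *g p >>.
Proof.
have [r ur er] := maxspec_over_seq p; rewrite (gcd_degreeE ur (esym er)).
have {ur er} : {in r, forall P, contraction P = p}.
  by move=> P Pr; apply/contraction_over; rewrite er.
elim: r => [|P r IH] hr; first by exists 0; rewrite big_nil raddf0 freegU0.
have [|X hX] := IH; first by move=> Q Qr; apply: hr; rewrite inE Qr orbT.
rewrite big_cons; set h := \big[gcdn/0%N]_(Q <- r) _ in hX *.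
have [u [w e]] := Bezoutz (deg P)%:Z h%:Z.
exists (<< u *g P >> + X *~ w).
rewrite raddfD raddfMz /= pushforwardU hX (hr P) ?mem_head // freeg_mulz freegUD.
by rewrite mulrzz [h%:Z * w]mulrC e.
Qed.

Lemma range_zmod_closed (G H : zmodType) (h : {additive G -> H}) :
  zmod_closed [in range h].
Proof.
split; first by rewrite inE; exists 0; rewrite ?raddf0.
move=> _ _ /set_mem [x _ <-] /set_mem [y _ <-]; rewrite inE.
by exists (x - y); rewrite ?raddfB.
Qed.

Lemma range_pushforward : range f =
  [set D : Div A | forall p, noninvertible A p -> (g p %| coeff p D)%Z].
Proof.
rewrite eqEsubset; split=> [_ [D _ <-] p _|D hD].
  have [r ur er] := maxspec_over_seq p.
  rewrite coeff_pushforward er -fsbig_seq // big_seq.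
  apply: rpred_sum => P Pr; apply: dvdz_mull.
  by apply: gcd_degree_dvd; rewrite er.
have hD' p : (g p %| coeff p D)%Z.
  case: (pselect (invertible_ideal A (val p))) => [/gcd_degree_invertible ->|]; last exact: hD.
  exact: dvd1z.
have [X hX] := choice pushforward_gcd.
exists (\sum_(p <- dom D) X p *~ (coeff p D %/ (g p)%:Z)%Z) => //.
rewrite raddf_sum /= -[RHS](freeg_sumE D); apply: eq_bigr => p _.
by rewrite raddfMz /= hX freeg_mulz mulrzz mulrC divzK.
Qed.

(** Above an invertible ideal there is one [P], of degree [1], so the
    push-forward loses nothing there. *)
Lemma pushforward_invertible_inj D P : f D = 0 ->
  invertible_ideal A (val (contraction P)) -> coeff P D = 0.
Proof.
move=> fD /invertible_over [Q eQ d1].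
have PQ : P = Q.
  have : maxspec_over B (contraction P) P by apply/contraction_over.
  by rewrite eQ.
have := coeff_pushforward D (contraction P).
by rewrite fD coeff0 eQ fsbig_set1 d1 mulr1 PQ.
Qed.

Lemma ker_pushforward : kerg f =
  [set D : Div B | exists2 a : maxspec B -> int,
     (forall p, noninvertible A p ->
        \sum_(P \in maxspec_over B p) a P * (deg P)%:Z = 0)
   & D = \sum_(p \in noninvertible A)
           \sum_(P \in maxspec_over B p) << a P *g P >>].
Proof.
rewrite eqEsubset; split=> [D fD|_ [a ha ->]].
  exists (fun P => coeff P D) => [p _|].
    by rewrite -coeff_pushforward fD coeff0.
  pose r := [seq p <- undup [seq contraction P | P <- dom D] | p \in noninvertible A].
  rewrite (fsbigE r); last 3 first.
  - by rewrite filter_uniq // undup_uniq.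
  - by move=> p /=; rewrite mem_filter => /andP [/set_mem].
  - move=> p Np; rewrite mem_filter mem_set //= mem_undup => pr.
    apply: fsbig1 => P /contraction_over PP.
    rewrite coeff_outdom ?freegU0 //; apply: contra pr => Pd.
    by apply/mapP; exists P.
  apply/eqP/freeg_eqP => Q /=; rewrite raddf_sum /=.
  have cX p : coeff Q (\sum_(P \in maxspec_over B p) << coeff P D *g P >>) =
      if contraction Q == p then coeff Q D else 0.
    rewrite coeff_fsum; last by apply: finite_setIl; exact: maxspec_over_finite.
    suff -> : (Q \in maxspec_over B p) = (contraction Q == p) by [].
    by apply/idP/eqP => [/set_mem/contraction_over|/contraction_over/mem_set].
  under eq_bigr do rewrite cX.
  have [Q0|Q0] := eqVneq (coeff Q D) 0.
    by rewrite big1 // => p _; case: eqP.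
  have NQ : noninvertible A (contraction Q).
    by move=> /(pushforward_invertible_inj fD)/eqP; apply/negP.
  rewrite big_mkcond (bigD1_seq (contraction Q)) /= ?mem_set //.
  - rewrite eqxx big1 ?addr0 // => p; rewrite eq_sym => /negPf ->.
    by case: ifP.
  - rewrite mem_filter mem_set //= mem_undup; apply/mapP; exists Q => //.
    by rewrite mem_dom.
  - by rewrite filter_uniq // undup_uniq.
rewrite /kerg /= raddf_sum /= big1_seq // => p /=.
(* With an infinite support the sum is [0], and there is nothing to prove. *)
case: finite_supportP => //= X XN _ _ pX; have Np := XN _ pX.
have [r ur er] := maxspec_over_seq p.
have := ha p Np; rewrite !er -!fsbig_seq // => hs.
transitivity (<< \sum_(P <- r) a P * (deg P)%:Z *g p >> : Div A); last first.
  by rewrite hs freegU0.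
rewrite -freegU_sum raddf_sum /=; apply: eq_big_seq => P Pr; rewrite pushforwardU.
by have -> : contraction P = p by apply/contraction_over; rewrite er.
Qed.

(** The isomorphism takes the coefficients of a divisor modulo the [g p].  For
    surjectivity one prescribes coefficients at the noninvertible [p] containing
    [d] only; these are finitely many, and at the others [g p] is [1]. *)
Lemma coker_pushforward :
  isomg (cokerg f) (prodg (fun p : noninvertible A => intmod (g (val p)))).
Proof.
have clg n : zmod_closed [in [set x : int | (n %| x)%Z]].
  split; first by rewrite inE /= dvdz0.
  by move=> x y /set_mem hx /set_mem hy; apply: mem_set; apply: rpredB.
pose h (D : Div A) : prodg (fun p : noninvertible A => intmod (g (val p))) :=
  fun p : noninvertible A => classg [set x : int | (g (val p) %| x)%Z] (coeff (val p : maxspec A) D).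
have hadd : zmod_morphism h.
  move=> D E; apply: functional_extensionality_dep => p.
  by rewrite /h coeffB classgB.
pose F : {additive Div A -> _} := HB.pack h (GRing.isZmodMorphism.Build _ _ _ hadd).
apply: (quotg_isom (h := F)) => [D|t].
  rewrite range_pushforward; split=> [e p Np|hD].
    have := congr1 (fun u => u (SigSub (mem_set Np))) e; rewrite /= /h /=.
    rewrite -[RHS](subrr (classg _ 0)) -classgB subr0 => /classg_eq.
    by rewrite subr0; apply; exact: clg.
  apply: functional_extensionality_dep => p; rewrite /h.
  rewrite -[RHS](subrr (classg _ 0)) -classgB subr0.
  apply/classg_eq; first exact: clg.
  by rewrite subr0; apply: hD; exact: set_mem (valP p).
pose c (p : maxspec A) : int :=
  if insub p is Some q then reprg (t q) else 0.
pose N0 := noninvertible A `&` [set p : maxspec A | val p d].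
exists (\sum_(p \in N0) << c p *g p >>).
apply: functional_extensionality_dep => p; rewrite /= /h.
have cp : c (val p) = reprg (t p) by rewrite /c valK.
rewrite coeff_fsum; last first.
  by apply/finite_setIl/finite_setIr; exact: finite_maxspec_containing.
rewrite -[RHS]reprgK; apply/classg_eq; first exact: clg.
case: ifPn => [_|]; first by rewrite cp subrr /= dvdz0.
rewrite notin_setE => /not_andP [[]|pd]; first exact: set_mem (valP p).
by move: (_ - _) => y /=; rewrite gcd_degree1 // dvd1z.
Qed.

Lemma pushforward_injective : injective f <->
  forall p, noninvertible A p -> (maxspec_over B p #= `I_1)%card.
Proof.
split=> [finj p _|h].
  have [P PP] := lying_over p.
  suff -> : maxspec_over B p = [set P] by exact: card_set1.
  rewrite eqEsubset; split=> [Q QP|_ -> //] /=.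
  (* Two ideals over [p] would give a nonzero kernel element. *)
  have : f << (deg P)%:Z *g Q >> = f << (deg Q)%:Z *g P >>.
    rewrite !pushforwardU mulrC.
    by have /contraction_over -> := PP; have /contraction_over -> := QP.
  move/finj/(congr1 (coeff Q)); rewrite !coeffU eqxx mulr1.
  case: eqP => // _; rewrite mulr0 => -[] e.
  by have := residue_degree_gt0 P; rewrite e.
have single p : exists P, maxspec_over B p = [set P].
  case: (pselect (invertible_ideal A (val p))) => [/invertible_over [P] |/h]; first by exists P.
  have [P PP] := lying_over p.
  move=> /pcard_eqP [k]; exists P; rewrite eqEsubset; split=> [Q QP|_ -> //] /=.
  have k0 R : maxspec_over B p R -> k R = 0%N.
    by move=> Rp; have : (k R < 1)%N := @funS _ _ _ _ k _ Rp; rewrite ltnS leqn0 => /eqP.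
  apply: (inj (f := k)); rewrite ?inE //.
  exact: etrans (k0 Q QP) (esym (k0 P PP)).
apply: raddf_inj => D fD; apply/eqP/freeg_eqP => P /=; rewrite coeff0.
have [Q eQ] := single (contraction P).
have PQ : P = Q.
  have : maxspec_over B (contraction P) P by apply/contraction_over.
  by rewrite eQ.
have := coeff_pushforward D (contraction P).
rewrite fD coeff0 eQ fsbig_set1 -PQ => /esym/eqP; rewrite mulf_eq0.
by case/orP => [/eqP //|/eqP[] e]; have := residue_degree_gt0 P; rewrite e.
Qed.

Local Notation fbar := (pushforward_chow A B).

Lemma principal_closed_ext : zmod_closed [in principal B].
Proof.
apply: principal_subgroup => //; first exact: extension_finite_length.
exact: extension_fraction_field.
Qed.

Lemma principal_closed : zmod_closed [in principal A].
Proof. exact: principal_subgroup. Qed.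

(** By [pushforward_principal], the push-forward maps the principal divisors of
    [B] onto those of [A]; the statements about Chow groups rest on this alone. *)
Lemma range_principal D : principal A D <-> exists2 E, principal B E & f E = D.
Proof.
split=> [[x /= x0 <-]|[_ [x /= x0 <-] <-]].
  by exists (principal_divisor B x); [exists x | exact: pushforward_principal].
by rewrite pushforward_principal //; exists x.
Qed.

Lemma pushforward_chowE D : fbar (classg (principal B) D) = classg (principal A) (f D).
Proof.
apply/(classg_eq _ _ principal_closed); rewrite -raddfB; apply/range_principal.
exists (reprg (classg (principal B) D) - D) => //.
by apply/(classg_eq _ _ principal_closed_ext); exact: reprgK.
Qed.

Lemma range_pushforward_chow : range fbar = [set classg (principal A) D | D in range f].
Proof.
rewrite eqEsubset; split=> [_ [u _ <-]|_ [_ [D _ <-] <-]].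
  by exists (f (reprg u)); [exists (reprg u) | rewrite -pushforward_chowE reprgK].
by exists (classg (principal B) D) => //; exact: pushforward_chowE.
Qed.

Lemma classg0 (G : zmodType) (S : set G) : classg S 0 = 0.
Proof. by rewrite -(subrr 0) classgB subrr. Qed.

Lemma ker_pushforward_chow : kerg fbar =
  [set classg (principal B) (D + E) | D in kerg f & E in principal B].
Proof.
rewrite eqEsubset; split=> [u|_ [D fD [E pE <-]]].
  rewrite -(reprgK u) /kerg /= pushforward_chowE -(classg0 (principal A)).
  move/(classg_eq _ _ principal_closed); rewrite subr0 => /range_principal [E pE e].
  exists (reprg u - E); first by rewrite /kerg /= raddfB /= e subrr.
  by exists E => //; rewrite subrK.
rewrite /kerg /= pushforward_chowE -(classg0 (principal A)).
apply/(classg_eq _ _ principal_closed); rewrite subr0 raddfD /= fD add0r.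
by apply/range_principal; exists E.
Qed.

Lemma coker_pushforward_chow : isomg (cokerg fbar) (cokerg f).
Proof.
have clf : zmod_closed [in range f] by exact: range_zmod_closed.
have prf D : principal A D -> range f D by move=> /range_principal [E _ <-]; exists E.
pose h (u : Chow A) : cokerg f := classg (range f) (reprg u).
have hE D : h (classg (principal A) D) = classg (range f) D.
  apply/(classg_eq _ _ clf)/prf/(classg_eq _ _ principal_closed); exact: reprgK.
have hadd : zmod_morphism h.
  move=> u w; rewrite -{1}(reprgK u) -{1}(reprgK w) -classgB hE.
  by rewrite classgB.
pose F : {additive Chow A -> cokerg f} := HB.pack h (GRing.isZmodMorphism.Build _ _ _ hadd).
apply: (quotg_isom (h := F)) => [u|y]; last first.
  by exists (classg (principal A) (reprg y)); rewrite -[LHS]/(h _) hE reprgK.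
rewrite -[F u]/(h u) range_pushforward_chow -[u]reprgK hE -(classg0 (range f)); split.
  move/(classg_eq _ _ clf); rewrite subr0 => hr; by exists (reprg u).
move=> [_ [D _ <-]] /(classg_eq _ _ principal_closed) /prf [E _ e].
apply/(classg_eq _ _ clf); rewrite subr0; exists (D - E) => //.
by rewrite raddfB /= e subKr.
Qed.

End FiniteExtension.

(** * The push-forward for an overring inside the normalization *)

Section NonField.
Variables (K : fieldType) (A : set K).

(** In a chain [p0 < p1] of primes, take [z] in [p1] outside [p0]. *)
Lemma krull_dim1_nonunit : krull_dim A 1 -> exists z, [/\ A z, z != 0 & ~ A z^-1].
Proof.
move=> [[c [cp cS]] _]; have [_ nsub] := cS 0%N erefl.
have [z z1 nz] : exists2 z, c 1%N z & ~ c 0%N z.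
  by apply: contrapT => H; apply: nsub => z z1; apply: contrapT => nz; apply: H; exists z.
have [[[c0 _ _] _] _ _] := cp 0%N erefl.
have [[[_ _ cM] cA] c1 _] := cp 1%N erefl.
have z0 : z != 0 by apply/eqP => e; apply: nz; rewrite e.
exists z; split=> //; first exact: cA.
by move=> Az; apply: c1; rewrite -(mulVf z0); exact: cM.
Qed.

End NonField.
Unset Implicit Arguments.
Set Strict Implicit.

Theorem lemma2p5 (K : fieldType) (O O' : set K)
    (subringO : subring O) (fracO : fraction_field O)
    (noethO : noetherian O) (dimO : krull_dim O 1)
    (fin_normO : finitely_generated O (normalization O))
    (subringO' : subring O') (leOO' : O `<=` O')
    (leO'norm : O' `<=` normalization O) :
  let f : Div O' -> Div O := pushforward O O' in
  let fbar : Chow O' -> Chow O := pushforward_chow O O' in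
  let g : maxspec O -> nat := gcd_degree O' in
  (* part (1) *)
  (range f =
     [set D : Div O | forall p, noninvertible O p -> (g p %| coeff p D)%Z] /\
   kerg f =
     [set D : Div O' | exists2 a : maxspec O' -> int,
        (forall p, noninvertible O p ->
           \sum_(P \in maxspec_over O' p) a P * (residue_degree O P)%:Z = 0)
      & D = \sum_(p \in noninvertible O)
              \sum_(P \in maxspec_over O' p) << a P *g P >>] /\
   isomg (cokerg f) (prodg (fun p : noninvertible O => intmod (g (val p)))) /\
   (injective f <->
      forall p, noninvertible O p -> (maxspec_over O' p #= `I_1)%card)) /\
  (* part (2); the first clause says that fbar is induced by f *)
  ((forall D, fbar (classg (principal O') D) = classg (principal O) (f D)) /\
   range fbar = [set classg (principal O) D | D in range f] /\
   kerg fbar =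
     [set classg (principal O') (D + E) | D in kerg f & E in principal O'] /\
   isomg (cokerg fbar) (cokerg f)).
Proof.
move=> f fbar g.
have finO := noetherian_finite_length subringO noethO
  (dim1_primes_maximal subringO noethO dimO).
have pmax := dim1_primes_maximal subringO noethO dimO.
have [z [Oz z0 nOz]] := krull_dim1_nonunit dimO.
have [s es] := fin_normO.
have [d [Od d0 hd]] := common_denominator subringO s fracO.
have dO' x : O' x -> O (d * x) by move=> /leO'norm; rewrite es => /hd.
split; last split; last split; last split.
- split; first exact: (range_pushforward subringO subringO' leOO' finO pmax Od d0 dO' Oz z0 nOz).
  split; first exact: (ker_pushforward subringO subringO' leOO' finO pmax Od d0 dO' Oz z0 nOz).
  split; first exact: (coker_pushforward subringO subringO' leOO' finO pmax Od d0 dO' Oz z0 nOz).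
  exact (pushforward_injective subringO subringO' leOO' finO pmax Od d0 dO' Oz z0 nOz).
- exact: (pushforward_chowE subringO subringO' leOO' fracO finO pmax Od d0 dO' Oz z0 nOz).
- exact: (range_pushforward_chow subringO subringO' leOO' fracO finO pmax Od d0 dO' Oz z0 nOz).
- exact: (ker_pushforward_chow subringO subringO' leOO' fracO finO pmax Od d0 dO' Oz z0 nOz).
- exact: (coker_pushforward_chow subringO subringO' leOO' fracO finO pmax Od d0 dO' Oz z0 nOz).
Qed.
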